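(* Let $\Theta$ be a finite simple oriented graph with $n$ vertices and let $k$ be a field. Then the Hecke--Kiselman algebra $A = k[\mathrm{HK}_{\Theta}]$ is an automaton algebra with respect to any deg-lex order on the free monoid $F$ of rank $n$ on the generators $x_1,\dots,x_n$ (that is, for the deg-lex order induced by any total order on the set of generators, the set $N(A)$ of normal words is a regular language). Consequently, the Gelfand--Kirillov dimension $\mathrm{GKdim}(A)$ of $A$ is an integer if it is finite.
   Context: A finite simple oriented graph $\Theta$ is a finite directed graph without loops in which any two distinct vertices are either not connected or connected by exactly one arrow (so all edges are arrows, at most one between any two vertices). Let its vertices be $1,\dots,n$. The Hecke--Kiselman monoid $\mathrm{HK}_\Theta$ is the monoid generated by $x_1,\dots,x_n$ subject to the relations: $x_i^2=x_i$ for all $i$; $x_ix_j=x_jx_i$ if $i,j$ are not connected in $\Theta$; $x_ix_jx_i=x_jx_ix_j=x_ix_j$ if there is an arrow $i\to j$ in $\Theta$. $k[\mathrm{HK}_\Theta]$ is its monoid algebra over $k$. Let $F$ be the free monoid on $x_1,\dots,x_n$ and $k[F]$ the free algebra. Given a total order on $\{x_1,\dots,x_n\}$, the induced deg-lex order on $F$ compares words first by length and then, for equal lengths, lexicographically. Let $\pi:k[F]\to A$ be the natural homomorphism (sending each $x_i$ to the corresponding generator of $\mathrm{HK}_\Theta$), and let $I\subseteq F$ be the set of leading monomials (with respect to the chosen deg-lex order) of nonzero elements of $\ker\pi$. The set of normal words is $N(A)=F\setminus I$. $A$ is an automaton algebra (with respect to the chosen generators and order) if $N(A)$ is a regular language,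 i.e. it is obtained from finite subsets of $F$ by finitely many operations of union, product and star. *)

(* Defs.v *)
From HB Require Import structures.
From mathcomp Require Import all_boot all_order all_algebra.
From mathcomp Require Import generic_quotient finmap monalg.
From mathcomp Require Import boolp classical_sets cardinality reals ereal.
From mathcomp Require Import sequences exp.

Set Implicit Arguments.
Unset Strict Implicit.
Unset Printing Implicit Defensive.

Import Order.TTheory GRing.Theory Num.Theory.

Local Open Scope quotient_scope.
Local Open Scope classical_set_scope.
Local Open Scope ring_scope.

Definition word (T : choiceType) : Type := seq T.

Section FreeMonoid.
Variable T : choiceType.

HB.instance Definition _ := Choice.on (word T).

Lemma cat_unit (u v : word T) : u ++ v = [::] -> u = [::] /\ v = [::].
Proof. by case: u v => [|x u] [|y v]. Qed.

(* [monalg] builds a ring structure on [{malg k[M]}] for [M : monomType], i.e.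
   for a monoid in which [x * y = 1] forces [x = y = 1]. *)
HB.instance Definition _ := Choice_isMonomialDef.Build (word T)
  (@catA T) (@cat0s T) (@cats0 T) cat_unit.

End FreeMonoid.

Section RegularLanguages.
Variable T : choiceType.
Implicit Types K L : set (word T).

Definition lang_prod K L : set (word T) := [set u ++ v | u in K & v in L].

Definition lang_star L : set (word T) :=
  [set flatten ws | ws in [set ws : seq (word T) | forall w, w \in ws -> L w]].

Inductive regular_language : set (word T) -> Prop :=
| regular_finite L : finite_set L -> regular_language L
| regular_union K L :
    regular_language K -> regular_language L -> regular_language (K `|` L)
| regular_prod K L :
    regular_language K -> regular_language L -> regular_language (lang_prod K L)
| regular_star L : regular_language L -> regular_language (lang_star L).

End RegularLanguages.

Section DegLex.
Variables (T : choiceType) (r : rel T).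

(* [total] includes reflexivity. *)
Definition total_order_rel : Prop :=
  [/\ antisymmetric r, transitive r & total r].

Fixpoint lexle (u v : seq T) : bool :=
  match u, v with
  | [::], _ => true
  | _ :: _, [::] => false
  | x :: u', y :: v' => r x y && ((x == y) ==> lexle u' v')
  end.

Definition deglex (u v : word T) : bool :=
  (size u < size v)%N || (size u == size v) && lexle u v.

End DegLex.

Section NormalWords.
Variables (k : fieldType) (T : choiceType) (r : rel T).

Definition is_leading_word (f : {malg k[word T]}) (w : word T) : Prop :=
  w \in msupp f /\ forall v, v \in msupp f -> deglex r v w.

Variables (A : nzRingType) (pi : {rmorphism {malg k[word T]} -> A}).

Definition leading_words : set (word T) :=
  [set w | exists f, [/\ f != 0, pi f = 0 & is_leading_word f w]].

Definition normal_words : set (word T) := ~` leading_words.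

Definition automaton_algebra : Prop := regular_language normal_words.

End NormalWords.

Record oriented_graph (n : nat) := OrientedGraph {
  arrow :> rel 'I_n;
  arrow_irreflexive : irreflexive arrow;
  arrow_asymmetric : forall i j, arrow i j -> ~~ arrow j i
}.

Section HeckeKiselmanMonoid.
Variables (n : nat) (Theta : oriented_graph n).

Implicit Types u v w : word 'I_n.

Inductive hk_relation : word 'I_n -> word 'I_n -> Prop :=
| hk_idem i : hk_relation [:: i; i] [:: i]
| hk_comm i j : ~~ Theta i j -> ~~ Theta j i ->
    hk_relation [:: i; j] [:: j; i]
| hk_iji i j : Theta i j -> hk_relation [:: i; j; i] [:: i; j]
| hk_jij i j : Theta i j -> hk_relation [:: j; i; j] [:: i; j].

Inductive hk_congr : word 'I_n -> word 'I_n -> Prop :=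
| hk_congr_rel u v : hk_relation u v -> hk_congr u v
| hk_congr_refl u : hk_congr u u
| hk_congr_sym u v : hk_congr u v -> hk_congr v u
| hk_congr_trans u v w : hk_congr u v -> hk_congr v w -> hk_congr u w
| hk_congr_cat u u' v v' :
    hk_congr u u' -> hk_congr v v' -> hk_congr (u ++ v) (u' ++ v').

Lemma hk_congr_nil u v : hk_congr u v -> (u == [::]) = (v == [::]).
Proof.
elim=> {u v} [u v []//|//|//|u v w _ -> _ ->//|u u' v v' _ + _].
by case: u u' v v' => [|? ?] [|? ?].
Qed.

Definition hk_eq : rel (word 'I_n) := fun u v => `[< hk_congr u v >].

Lemma hk_eq_refl : reflexive hk_eq.
Proof. by move=> u; apply/asboolP; exact: hk_congr_refl. Qed.

Lemma hk_eq_sym : symmetric hk_eq.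
Proof. by move=> u v; apply/asboolP/asboolP; exact: hk_congr_sym. Qed.

Lemma hk_eq_trans : transitive hk_eq.
Proof.
move=> v u w /asboolP uv /asboolP vw; apply/asboolP.
exact: hk_congr_trans uv vw.
Qed.

Canonical hk_equiv := EquivRel hk_eq hk_eq_refl hk_eq_sym hk_eq_trans.

Definition HK : Type := {eq_quot hk_equiv}.

HB.instance Definition _ := Choice.on HK.

Definition hk_class (u : word 'I_n) : HK := (\pi_({eq_quot hk_equiv}) u)%qT.

Definition hk_repr (x : HK) : word 'I_n := repr (x : {eq_quot hk_equiv}).

Lemma hk_reprK : cancel hk_repr hk_class.
Proof. by move=> x; exact: reprK. Qed.

Lemma hk_classP u v : hk_class u = hk_class v <-> hk_congr u v.
Proof. by split=> [/eqmodP/asboolP|uv]; last by apply/eqmodP/asboolP. Qed.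

Definition hk_one : HK := hk_class [::].

Definition hk_mul (x y : HK) : HK := hk_class (hk_repr x ++ hk_repr y).

Lemma hk_class_cat u v : hk_class (u ++ v) = hk_mul (hk_class u) (hk_class v).
Proof. by apply/hk_classP/hk_congr_cat; apply/hk_classP; rewrite hk_reprK. Qed.

Lemma hk_mulA : associative hk_mul.
Proof.
move=> x y z; rewrite -(hk_reprK x) -(hk_reprK y) -(hk_reprK z).
by rewrite -!hk_class_cat catA.
Qed.

Lemma hk_mul1 : left_id hk_one hk_mul.
Proof. by move=> x; rewrite -(hk_reprK x) -hk_class_cat. Qed.

Lemma hk_mulr1 : right_id hk_one hk_mul.
Proof. by move=> x; rewrite -(hk_reprK x) -hk_class_cat cats0. Qed.

Lemma hk_mul_unit x y : hk_mul x y = hk_one -> x = hk_one /\ y = hk_one.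
Proof.
move=> /hk_classP/hk_congr_nil; rewrite eqxx => /eqP/cat_unit[x1 y1].
by rewrite -(hk_reprK x) -(hk_reprK y) x1 y1.
Qed.

HB.instance Definition _ := Choice_isMonomialDef.Build HK
  hk_mulA hk_mul1 hk_mulr1 hk_mul_unit.

Definition hk_gen (i : 'I_n) : HK := hk_class [:: i].

End HeckeKiselmanMonoid.

Section HeckeKiselmanAlgebra.
Variables (k : fieldType) (n : nat) (Theta : oriented_graph n).

Definition hk_algebra := {malg k[HK Theta]}.

HB.instance Definition _ := GRing.Lalgebra.on hk_algebra.

Definition hk_word_embed (w : word 'I_n) : hk_algebra := << hk_class Theta w >>.

Lemma hk_word_embed_mmorphism : mmorphism hk_word_embed.
Proof.
split=> // u v; rewrite /hk_word_embed hk_class_cat.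
by rewrite [RHS]fgmulUU mulr1.
Qed.

HB.instance Definition _ := isMultiplicative.Build (word 'I_n) hk_algebra
  hk_word_embed hk_word_embed_mmorphism.

Definition hk_proj (f : {malg k[word 'I_n]}) : hk_algebra :=
  mmap (@malgC (HK Theta) k) hk_word_embed f.

Lemma hk_proj_additive : additive hk_proj.
Proof. exact: mmap_is_additive. Qed.

Lemma hk_proj_multiplicative : multiplicative hk_proj.
Proof.
apply: commr_mmap_is_multiplicative => g m m'.
rewrite /GRing.comm /= [LHS]fgmulUU [RHS]fgmulUU.
by rewrite mulrC mul1m mulm1.
Qed.

HB.instance Definition _ := GRing.isAdditive.Build _ _ hk_proj hk_proj_additive.
HB.instance Definition _ :=
  GRing.isMultiplicative.Build _ _ hk_proj hk_proj_multiplicative.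

Lemma hk_proj_word (c : k) (w : word 'I_n) :
  hk_proj << c *g w >> = << c *g hk_class Theta w >>.
Proof. by rewrite /hk_proj mmapU [LHS]fgmulUU mulr1 mul1m. Qed.

Lemma hk_proj_gen (i : 'I_n) :
  hk_proj << ([:: i] : word 'I_n) >> = << hk_gen Theta i >>.
Proof. exact: hk_proj_word. Qed.

End HeckeKiselmanAlgebra.

Section Dimension.
Variables (k : fieldType) (V : lmodType k).

Definition lin_span (S : set V) : set V :=
  [set x | exists2 s : seq (k * V),
     forall p, p \in s -> S p.2 & x = \sum_(p <- s) p.1 *: p.2].

Definition lin_indep (s : seq V) : Prop :=
  forall c : nat -> k,
    \sum_(i < size s) c i *: s`_i = 0 -> forall i, (i < size s)%N -> c i = 0.

Definition is_basis (W : set V) (s : seq V) : Prop :=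
  lin_indep s /\ lin_span [set` s] = W.

Definition findim_subspace (W : set V) : Prop := exists s, is_basis W s.

(* Meaningful for finite-dimensional subspaces only (0 otherwise). *)
Definition subspace_dim (W : set V) : nat :=
  xget 0%N [set size s | s in is_basis W].

End Dimension.

Section GelfandKirillov.
Variables (R : realType) (k : fieldType) (A : lalgType k).

(* k + V + V^2 + ... + V^n; the empty product provides the summand k. *)
Definition filtration (V : set A) (n : nat) : set A :=
  lin_span [set \prod_(v <- s) v | s in
    [set s : seq A | (size s <= n)%N /\ forall v, v \in s -> V v]].

Definition growth (V : set A) (n : nat) : nat :=
  subspace_dim (filtration V n).

Definition GKdim : \bar R :=
  ereal_sup [set limn_esup (fun n => (ln (growth V n)%:R / ln n%:R : R)%:E)
            | V in @findim_subspace k A].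

End GelfandKirillov.

(* Main.v *)
Require Import Defs.
From mathcomp Require Import all_boot all_order all_algebra.
From mathcomp Require Import generic_quotient finmap monalg.
From mathcomp Require Import boolp classical_sets cardinality reals ereal.
From mathcomp Require Import sequences exp.
From mathcomp Require Import zify ring lra.

Set Implicit Arguments.
Unset Strict Implicit.
Unset Printing Implicit Defensive.

(** A word is normal exactly when it is the deg-lex least word of its class in
    the monoid: the kernel of a monoid algebra presentation is spanned by the
    differences [u - v] of congruent words (lemma [normal_minimal]). So
    everything rests on recognising least words by local inspection.

    The defining relations imply [t w t = t w] when no letter of [w] has an
    arrow into [t], and [t w t = w t] when [t] has no arrow into a letter of
    [w]. Thus an occurrence of [t] may be deleted when, going left from it,
    one meets another [t] before any letter with an arrow into [t], or, going
    right, another [t] before any letter that receives an arrow from [t].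
    Together with the commutations [x y = y x] of unconnected letters these
    deletions present the monoid, and modulo commutations they are confluent
    ([del_diamond], [swap_del]), so two congruent words that admit no deletion
    differ by commutations only ([hk_congr_same_nf]). Among the words that
    differ by commutations, a word is lexicographically least unless some
    letter [t] can travel to the left past a letter that is larger than [t]
    ([trace_lexle]). Hence a word is least iff it admits no deletion and no
    such move ([minimalP]).

    Each of these conditions, read from left to right, concerns one letter [t]
    at a time and depends on the prefix through one bit that is updated letter
    by letter ([scan], [shift_scan]). Recording three bits for every letter
    gives a finite partial automaton which reads exactly the normal words
    ([readable_minimal]), and Kleene's theorem turns it into a regular
    expression ([regular_readable]).

    For the dimension, the number of normal words of length at most [m] is the
    number of walks of length at most [m] in a finite weighted graph. Cutting a
    walk at its last visit to a vertex [q] shows, by induction on the set of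
    available vertices, that this number is either at least exponential (some
    vertex carries two closed walks of the same length) or of order [m ^ e] for
    a natural number [e] ([walks_growth_dichotomy]). The span of the words of
    length at most one generates the algebra, its filtration has the normal
    words as bases, and the filtration of any other finite-dimensional subspace
    is contained in it up to rescaling [m] ([growth_letters], [growth_le]). So
    the dimension is infinite in the first case and equal to [e] in the
    second. *)

(** * Regular languages and partial automata *)

Section Automata.
Variables (Q T : finType) (step : Q -> T -> option Q).
Local Open Scope classical_set_scope.

Fixpoint readable (q : Q) (w : seq T) : bool :=
  if w is x :: w' then if step q x is Some q' then readable q' w' else false
  else true.

(** [S] constrains the intermediate states only, not the two end states: this
    makes a concatenation at [r] stay in the same family as soon as [r] is in [S]. *)
Inductive path_via (S : {set Q}) : Q -> seq T -> Q -> Prop :=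
| via_nil p : path_via S p [::] p
| via_edge p x q : step p x = Some q -> path_via S p [:: x] q
| via_cons p x p' w q : step p x = Some p' -> p' \in S ->
    path_via S p' w q -> path_via S p (x :: w) q.

Lemma path_viaS (S S' : {set Q}) p w q :
  S \subset S' -> path_via S p w q -> path_via S' p w q.
Proof.
move=> /fintype.subsetP sub; elim=> {p w q} [p|p x q pq|p x p' w q pp' p'S _ IH].
- exact: via_nil.
- exact: via_edge.
- exact: via_cons pp' (sub _ p'S) IH.
Qed.

Lemma path_via_cat (S : {set Q}) p u r v q : r \in S ->
  path_via S p u r -> path_via S r v q -> path_via S p (u ++ v) q.
Proof.
move=> rS pr; elim: pr rS => {p u r} [//|p x r pr rS|p x p' u r pp' p'S _ IH rS].
  exact: via_cons pr rS.
by move=> rq; apply: via_cons pp' p'S (IH rS rq).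
Qed.

Definition via_lang (S : {set Q}) p q : set (word T) := [set w | path_via S p w q].

(** The McNaughton-Yamada recursion: a path that may pass through [r] is cut at
    its visits to [r]. *)
Lemma via_langU1 (S : {set Q}) r p q :
  via_lang (r |: S) p q = via_lang S p q `|`
    lang_prod (via_lang S p r)
      (lang_prod (lang_star (via_lang S r r)) (via_lang S r q)).
Proof.
apply/seteqP; split=> [w /= pq|w].
  elim: pq => {p w q} [p|p x q pq|p x p' w q pp' p'S _ IH].
  - by left; apply: via_nil.
  - by left; apply: via_edge.
  have step_ u s : p' \in S -> path_via S p' u s -> path_via S p (x :: u) s.
    exact: via_cons.
  (* The induction cuts the remaining path; the first edge is put in front of the
     first piece, unless it already leads to [r] and is a piece by itself. *)
  case: (eqVneq p' r) => [eqr|p'r]; last first.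
    have {}p'S : p' \in S by move: p'S; rewrite !inE (negPf p'r).
    case: IH => [wq|[u ur [v vq uvw]]]; first by left; apply: step_.
    by right; exists (x :: u); [apply: step_ | exists v; rewrite //= uvw].
  right; exists [:: x]; first by apply: via_edge; rewrite pp' eqr.
  rewrite eqr in IH; case: IH => [wq|[u ur [v [_ [ws wsr <-] [v' v'q vE] uvw]]]].
    by exists w => //; exists [::]; [exists [::] | exists w].
  exists w => //; rewrite -uvw -vE.
  exists (u ++ flatten ws); last by exists v' => //; rewrite catA.
  exists (u :: ws) => // y; rewrite inE => /orP[/eqP->//|]; exact: wsr.
have sub : S \subset r |: S by apply: subsetU1.
have rS : r \in r |: S by rewrite !inE eqxx.
case=> [pq|[u ur [_ [_ [ws wsr <-] [v vq <-]] <-]]].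
  exact: (path_viaS sub pq).
apply: (path_via_cat rS (path_viaS sub ur)).
have : path_via (r |: S) r (flatten ws) r.
  elim: ws wsr => [|y ws IH] wsr; first exact: via_nil.
  apply: (path_via_cat rS).
    by apply: (path_viaS sub); apply: wsr; rewrite inE eqxx.
  by apply: IH => z zws; apply: wsr; rewrite inE zws orbT.
by move/(path_via_cat rS); apply; exact: (path_viaS sub).
Qed.

Lemma regular_via_lang (S : {set Q}) p q : regular_language (via_lang S p q).
Proof.
have [k le_k] := ubnP #|S|; elim: k => // k IHk in S p q le_k *.
have [->|[r rS]] := set_0Vmem S; last first.
  have IH p' q' : regular_language (via_lang (S :\ r) p' q').
    by apply: IHk; move: le_k; rewrite (cardsD1 r S) rS.
  rewrite -(finset.setD1K rS) via_langU1; apply: regular_union; first exact: IH.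
  apply: regular_prod; first exact: IH.
  by apply: regular_prod; [apply: regular_star; apply: IH | apply: IH].
apply: regular_finite.
apply: (@sub_finite_set _ _ [set` [::] :: [seq [:: x] | x <- enum T]]); last first.
  exact: finite_seq.
move=> w /=; case=> // [p' x q' _|p' x p'' w' q' _]; last by rewrite inE.
by rewrite inE /=; apply: map_f; rewrite mem_enum.
Qed.

Lemma readableP (q : Q) w : readable q w <-> exists q', path_via [set: Q]%SET q w q'.
Proof.
split=> [|[q']].
  elim: w q => [|x w IH] q /=; first by exists q; apply: via_nil.
  case E: step => [p|//] /IH[q' pq']; exists q'.
  by apply: via_cons E _ pq'; rewrite inE.
by elim=> {q w q'} [//|p x q /= -> //|p x p' w q /= -> //].
Qed.

Lemma regular_bigcup (I : Type) (s : seq I) (L : I -> set (word T)) :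
  (forall i, regular_language (L i)) ->
  regular_language (\big[setU/set0]_(i <- s) L i).
Proof.
move=> reg; elim: s => [|i s IH].
  by rewrite big_nil; apply: regular_finite; exact: finite_set0.
by rewrite big_cons; apply: regular_union.
Qed.

Lemma regular_readable (q : Q) :
  regular_language [set w : word T | readable q w].
Proof.
have -> : [set w : word T | readable q w] =
    \big[setU/set0]_(q' <- enum Q) via_lang [set: Q]%SET q q'.
  rewrite -bigcup_seq; apply/seteqP; split=> [w /readableP[q' qq']|w [q' _ qq']].
    by exists q' => //=; rewrite mem_enum.
  by apply/readableP; exists q'.
by apply: regular_bigcup => q'; apply: regular_via_lang.
Qed.

End Automata.

Section FlagAutomaton.
Variables (T E : finType) (upd : T -> E -> T -> E) (bad : pred E).

(** One flag per letter is updated independently of the others; reading a letter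
    whose own flag is bad kills the run. *)
Definition flag_step (s : {ffun T -> E}) (x : T) : option {ffun T -> E} :=
  if bad (s x) then None else Some [ffun t => upd t (s t) x].

Lemma readable_flags (s : {ffun T -> E}) (w : seq T) :
  readable flag_step s w <->
  forall p t q, w = p ++ t :: q -> ~~ bad (foldl (upd t) (s t) p).
Proof.
elim: w s => [|x w IH] s; first by split=> // _ [].
rewrite /= /flag_step; have [bx|bx] := boolP (bad (s x)).
  by split=> // /(_ [::] x w erefl); rewrite bx.
split=> [/IH rw [|y p] t q /= [<- //]|rw]; last apply/IH => p t q wE.
  by move/rw; rewrite ffunE.
by have := rw (x :: p) t q; rewrite /= ffunE wE => /(_ erefl).
Qed.

End FlagAutomaton.

(** * Counting the words read by a partial automaton *)

Section GrowthFunctions.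

(** Rescaling the argument by [c] in the lower bounds keeps them stable under the
    shifts and the periodic loops below, and does not change the exponent. *)
Definition poly_upper e (F : nat -> nat) :=
  exists C, forall m, F m <= C * m.+1 ^ e.

Definition poly_lower e (F : nat -> nat) :=
  exists2 c, 0 < c & forall m, m.+1 ^ e <= c * F (c * m).

Definition exponential (F : nat -> nat) := exists c, forall m, 2 ^ m <= F (c * m).

Definition growth_dichotomy F :=
  exponential F \/ exists e, poly_lower e F /\ poly_upper e F.

Lemma exponential_le F G : (forall m, F m <= G m) -> exponential F -> exponential G.
Proof. by move=> le [c Fc]; exists c => m; apply: leq_trans (Fc m) (le _). Qed.

Lemma poly_lower_le e F G : (forall m, F m <= G m) ->
  poly_lower e F -> poly_lower e G.
Proof.
move=> le [c c0 Fc]; exists c => // m; apply: leq_trans (Fc m) _.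
by rewrite leq_mul2l le orbT.
Qed.

Lemma poly_upperW e e' F : e <= e' -> poly_upper e F -> poly_upper e' F.
Proof.
move=> le [C FC]; exists C => m; apply: leq_trans (FC m) _.
by rewrite leq_mul2l leq_pexp2l ?orbT.
Qed.

Lemma growth_dichotomy_ext F G : F =1 G -> growth_dichotomy F -> growth_dichotomy G.
Proof.
move=> eqFG [[c Fc]|[e [[c c0 Fc] [C FC]]]]; [left|right].
  by exists c => m; rewrite -eqFG.
by exists e; split; [exists c => // m|exists C => m]; rewrite -eqFG.
Qed.

Lemma growth_dichotomy_cst1 : growth_dichotomy (fun=> 1).
Proof. by right; exists 0; split; exists 1. Qed.

Lemma growth_dichotomyD F G a : growth_dichotomy F -> growth_dichotomy G ->
  growth_dichotomy (fun m => F m + a * G m).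
Proof.
case: (posnP a) => [-> dF _|a0 dF dG].
  by apply: growth_dichotomy_ext dF => m; rewrite mul0n addn0.
have leF m : F m <= F m + a * G m by rewrite leq_addr.
have leG m : G m <= F m + a * G m by rewrite -[G m]add0n leq_add ?leq_pmull.
case: dF => [/(exponential_le leF)|[e [lF uF]]]; first by left.
case: dG => [/(exponential_le leG)|[e' [lG uG]]]; first by left.
right; exists (maxn e e'); split.
  case: (leqP e e') => _; [exact: poly_lower_le lG|exact: poly_lower_le lF].
have [C FC] := poly_upperW (leq_maxl e e') uF.
have [D GD] := poly_upperW (leq_maxr e e') uG.
exists (C + a * D) => m; rewrite mulnDl leq_add //.
by rewrite -mulnA leq_mul2l GD orbT.
Qed.

Lemma growth_dichotomy_sum (I : Type) (s : seq I) (P : pred I) (a : I -> nat)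
    (F : I -> nat -> nat) :
  (forall i, P i -> growth_dichotomy (F i)) ->
  growth_dichotomy (fun m => 1 + \sum_(i <- s | P i) a i * F i m).
Proof.
move=> dF; elim: s => [|i s IH].
  by apply: growth_dichotomy_ext growth_dichotomy_cst1 => m; rewrite big_nil.
case Pi: (P i); last first.
  by apply: growth_dichotomy_ext IH => m; rewrite big_cons Pi.
apply: growth_dichotomy_ext (growth_dichotomyD (a i) IH (dF i Pi)) => m.
by rewrite big_cons Pi addnAC addnA.
Qed.

Lemma growth_dichotomy_shift F : {homo F : m p / m <= p} ->
  growth_dichotomy F -> growth_dichotomy (fun m => if m is m'.+1 then F m' else 1).
Proof.
move=> homF; set H := (fun m => _).
have Hle c m : 0 < m -> F (c * m) <= H (c.+1 * m).
  case: m => // m _; rewrite mulSn addSn /=; apply: homF; lia.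
case=> [[c Fc]|[e [[c c0 Fc] [C FC]]]]; [left|right].
  by exists c.+1 => -[|m]; rewrite ?muln0 //; apply: leq_trans (Hle _ _ _).
exists e; split.
  exists c.+1 => // -[|m]; first by rewrite muln0 exp1n.
  apply: leq_trans (Fc _) _; apply: leq_mul => //; exact: Hle.
exists C.+1 => -[|m] /=; first by rewrite exp1n.
apply: leq_trans (FC _) _; apply: leq_mul => //.
by case: e {Fc FC} => [|e] //; rewrite leq_exp2r.
Qed.

(** [rho] counts the closed walks at a vertex, at most one for every length, and
    [H] counts the continuations that never return. At least one start in every
    [l] and at most all of them contribute, so the degree goes up by one. *)
Lemma growth_dichotomy_conv (rho H : nat -> nat) l :
  rho 0 = 1 -> (forall i, rho i <= 1) -> 0 < l -> (forall j, rho (j * l) = 1) ->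
  {homo H : m p / m <= p} ->
  growth_dichotomy H -> growth_dichotomy (fun m => \sum_(i < m.+1) rho i * H (m - i)).
Proof.
move=> rho0 rho1 l0 rhol homH; set F := (fun m => _).
have leF m : H m <= F m.
  by rewrite /F big_ord_recl /= rho0 mul1n subn0 leq_addr.
case=> [/(exponential_le leF)|[e [[c c0 Hc] [C HC]]]]; first by left.
right; exists e.+1; split; last first.
  exists C => m; rewrite /F.
  apply: (@leq_trans (\sum_(i < m.+1) C * m.+1 ^ e)).
    apply: leq_sum => i _; rewrite -[leqRHS]mul1n; apply: leq_mul => //.
    by apply: leq_trans (homH _ _ (leq_subr i m)) (HC m).
  by rewrite sum_nat_const card_ord expnS mulnCA.
exists (c + l) => [|m]; first by rewrite addn_gt0 c0.
(* Only the terms [i = j * l] with [j <= m] are kept. *)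
have geF M : \sum_(j < m.+1) H (M - j * l) <= F M \/ M < m * l.
  case: (leqP (m * l) M) => [leM|]; [left|by right].
  have inj (j : 'I_m.+1) : j * l < M.+1.
    by rewrite ltnS; apply: leq_trans leM; rewrite leq_mul2r -ltnS ltn_ord orbT.
  pose h j := Ordinal (inj j).
  have injh : injective h.
    move=> i j /(congr1 val) /= /eqP; rewrite eqn_pmul2r // => /eqP ij.
    exact: val_inj.
  rewrite /F (bigID [in [set h j | j in 'I_m.+1]%SET]) /=.
  rewrite [X in _ <= X + _]big_imset /=; last by move=> x y _ _; exact: injh.
  apply: leq_trans (leq_addr _ _); apply: leq_sum => j _.
  by rewrite rhol mul1n.
(* With [M = (c + l) * m] each of the [m + 1] terms kept is at least [H (c * m)]. *)
case: (geF ((c + l) * m)) => [le|]; last by lia.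
rewrite expnS.
apply: leq_trans (leq_mul (leqnn _) (Hc m)) _.
rewrite mulnCA; apply: leq_mul; first by rewrite leq_addr.
apply: leq_trans le; rewrite -[m.+1 in leqLHS]card_ord -sum_nat_const.
apply: leq_sum => j _; apply: homH.
rewrite mulnDl (mulnC l) -addnBA ?leq_addr //.
by rewrite leq_mul2r -ltnS ltn_ord orbT.
Qed.

Lemma exponential_poly_lower e F : exponential F -> poly_lower e F.
Proof.
case=> c Fc.
have c0 : 0 < c.
  by case: c Fc => // /(_ (F 0)); rewrite mul0n leqNgt ltn_expl.
(* The factor [e.+1] rather than [e] keeps the constant positive when [e = 0]. *)
exists (c * e.+1) => [|m]; first by rewrite muln_gt0 c0.
apply: (@leq_trans (2 ^ (e.+1 * m))); last first.
  by apply: leq_trans (Fc _) _; rewrite mulnA leq_pmull // muln_gt0 c0.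
apply: (@leq_trans (2 ^ (m * e))); last by rewrite leq_exp2l // mulnC leq_mul2r leqnSn orbT.
have [->|e0] := posnP e; first by rewrite muln0.
by rewrite expnM leq_exp2r // ltn_expl.
Qed.

End GrowthFunctions.

Section Walks.
Variables (Q : finType) (A : Q -> Q -> nat).
Implicit Types S : {set Q}.

(** [A p p'] is the number of edges from [p] to [p'], so that [walks] and
    [walks_to] are row sums and entries of the powers of the matrix [A]
    restricted to [S]. *)
Fixpoint walks (S : {set Q}) (p : Q) (m : nat) : nat :=
  if p \in S then
    if m is m'.+1 then \sum_p' A p p' * walks S p' m' else 1
  else 0.

Fixpoint walks_to (S : {set Q}) (q p : Q) (m : nat) : nat :=
  if p \in S then
    if m is m'.+1 then \sum_p' A p p' * walks_to S q p' m' else nat_of_bool (p == q)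
  else 0.

Lemma walksS S p m : walks S p m.+1 =
  if p \in S then \sum_p' A p p' * walks S p' m else 0.
Proof. by []. Qed.

Lemma walks_toS S q p m : walks_to S q p m.+1 =
  if p \in S then \sum_p' A p p' * walks_to S q p' m else 0.
Proof. by []. Qed.

Lemma walks_notin S p m : p \notin S -> walks S p m = 0.
Proof. by case: m => [|m] /= /negPf->. Qed.

Lemma walks_to_notin S q p m : p \notin S -> walks_to S q p m = 0.
Proof. by case: m => [|m] /= /negPf->. Qed.

(** The walks from [q] in [S] that never come back to [q]. *)
Definition last_walks S q m :=
  if m is m'.+1 then \sum_p A q p * walks (S :\ q) p m' else 1.

(** A walk either avoids [q] or is cut in two at its last visit to [q]. *)
Lemma walks_last_visit S q p m : q \in S ->
  walks S p m = walks (S :\ q) p m +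
    \sum_(i < m.+1) walks_to S q p i * last_walks S q (m - i).
Proof.
move=> qS; elim: m p => [|m IH] p.
  rewrite big_ord1 /= !inE muln1; case: (eqVneq p q) => [->|pq]; rewrite ?qS //.
  by case: (p \in S).
case pS: (p \in S); last first.
  rewrite !walks_notin ?inE ?pS ?andbF //.
  by rewrite add0n big1 // => i _; rewrite walks_to_notin ?pS.
rewrite walksS pS; under eq_bigr => p' _ do rewrite IH mulnDr.
rewrite big_split /= -/walks big_ord_recl /= pS.
have -> : \sum_p' A p p' * (\sum_(i < m.+1) walks_to S q p' i * last_walks S q (m - i)) =
   \sum_(i < m.+1) walks_to S q p (bump 0 i) * last_walks S q (m.+1 - bump 0 i).
  under eq_bigr => p' _ do rewrite big_distrr /=.
  rewrite exchange_big; apply: eq_bigr => i _.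
  rewrite /bump leq0n add1n subSS walks_toS pS big_distrl /=.
  by apply: eq_bigr => p' _; rewrite mulnA.
rewrite !inE pS; case: (eqVneq p q) => [->|pq] /=.
  by rewrite qS add0n mul1n.
by rewrite pS mul0n.
Qed.

Lemma walks_to_cat S q p a b :
  walks_to S q p a * walks_to S q q b <= walks_to S q p (a + b).
Proof.
elim: a p => [|a IH] p /=.
  by case: ifP => // pS; case: eqVneq => [->|]; rewrite ?mul1n.
case: ifP => // pS; rewrite big_distrl /=; apply: leq_sum => p' _.
by rewrite -mulnA leq_mul2l IH orbT.
Qed.

Lemma walks_to_le S q p m : walks_to S q p m <= walks S p m.
Proof.
elim: m p => [|m IH] p /=; case: ifP => // pS; first by case: eqP.
by apply: leq_sum => p' _; rewrite leq_mul2l IH orbT.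
Qed.

Definition walks_upto S p m := \sum_(j < m.+1) walks S p j.

Lemma walks_upto_homo S p : {homo walks_upto S p : m m' / m <= m'}.
Proof.
move=> m m' le; rewrite /walks_upto -!(big_mkord xpredT (walks S p)).
by rewrite [leqRHS](big_cat_nat (n := m.+1)) /= ?leq_addr.
Qed.

Lemma walks_upto_ge S p j m : j <= m -> walks S p j <= walks_upto S p m.
Proof.
move=> jm; rewrite /walks_upto.
by rewrite (bigD1 (Ordinal (jm : j < m.+1))) //= leq_addr.
Qed.

Lemma walks_upto_gt0 S p m : p \in S -> 0 < walks_upto S p m.
Proof. by move=> pS; apply: leq_trans (walks_upto_ge S p (leq0n m)); rewrite /= pS. Qed.

(** Two closed walks of the same length [i] at [q] can be concatenated in any
    order, and the [2 ^ j] concatenations of [j] of them are distinct. *)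
Lemma two_loops_exponential S p q a i : 0 < walks_to S q p a ->
  1 < walks_to S q q i -> exponential (walks_upto S p).
Proof.
move=> pq qq.
have pS : p \in S by apply: contraLR pq => /walks_to_notin->.
exists (a + i) => -[|m]; first by rewrite muln0 walks_upto_gt0.
have loops j : 2 ^ j <= walks_to S q q (j * i).
  elim: j => [|j IH].
    by rewrite /=; case: ifP qq => [|/negbT/walks_to_notin->//]; rewrite eqxx.
  rewrite expnS [j.+1 * i]mulSn; apply: leq_trans (walks_to_cat _ _ _ _ _).
  by apply: leq_mul.
apply: (leq_trans _ (walks_upto_ge _ _ (_ : a + m.+1 * i <= _))); last by nia.
apply: leq_trans (walks_to_le _ q _ _); apply: leq_trans (walks_to_cat _ _ _ _ _).
by rewrite -[leqLHS]mul1n leq_mul.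
Qed.

Lemma walks_upto_last S q m : q \in S ->
  walks_upto S q m =
  \sum_(i < m.+1) walks_to S q q i * \sum_(j < (m - i).+1) last_walks S q j.
Proof.
move=> qS; rewrite /walks_upto.
under eq_bigr => j _.
  rewrite (walks_last_visit _ _ qS) walks_notin ?inE ?eqxx // add0n.
  over.
elim: m => [|m IH]; first by rewrite !big_ord1.
rewrite big_ord_recr /= IH [RHS]big_ord_recr /= subnn big_ord1.
rewrite [X in _ + X = _]big_ord_recr /= subnn addnA; congr (_ + _).
rewrite -big_split /=; apply: eq_bigr => i _.
have im : i <= m by rewrite -ltnS.
by rewrite -mulnDr subSn // [in RHS]big_ord_recr.
Qed.

(** By induction on [S]: the walks are the convolution of the closed walks at [p]
    with the walks that leave [p] for good, and the latter run in [S :\ p] after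
    their first step. *)
Theorem walks_growth_dichotomy S p : p \in S -> growth_dichotomy (walks_upto S p).
Proof.
have [k le_k] := ubnP #|S|; elim: k => // k IH in S p le_k *; move=> pS.
pose H m := \sum_(j < m.+1) last_walks S p j.
have homH : {homo H : m m' / m <= m'}.
  move=> m m' le; rewrite /H -!(big_mkord xpredT (last_walks S p)).
  by rewrite [leqRHS](big_cat_nat (n := m.+1)) /= ?leq_addr.
have dH : growth_dichotomy H.
  pose G m := 1 + \sum_(p' | p' \in S :\ p) A p p' * walks_upto (S :\ p) p' m.
  have dG : growth_dichotomy G.
    apply: growth_dichotomy_sum => p' p'S; apply: IH => //.
    by rewrite -ltnS; apply: leq_trans le_k; rewrite (cardsD1 p S) pS add1n.
  have homG : {homo G : m m' / m <= m'}.
    move=> m m' le; rewrite leq_add2l; apply: leq_sum => p' _.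
    by rewrite leq_mul2l walks_upto_homo ?orbT.
  apply: growth_dichotomy_ext (growth_dichotomy_shift homG dG) => //.
  case=> [|m]; first by rewrite /H big_ord1.
  rewrite /H big_ord_recl /=; congr (1 + _).
  rewrite /= /walks_upto; under [in LHS]eq_bigr => p' _ do rewrite big_distrr /=.
  rewrite exchange_big; apply: eq_bigr => j _ /=.
  rewrite [RHS](bigID [in S :\ p]) /= [X in _ + X]big1 ?addn0 //.
  by move=> p' p'S; rewrite walks_notin ?muln0.
have ext m : \sum_(i < m.+1) walks_to S p p i * H (m - i) = walks_upto S p m.
  by rewrite walks_upto_last.
have loop0 : walks_to S p p 0 = 1 by rewrite /= pS eqxx.
have [[i loop2]|noloop2] := EM (exists i, 1 < walks_to S p p i).
  by left; apply: (@two_loops_exponential S p p 0 i); rewrite ?loop0.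
have le1 i : walks_to S p p i <= 1.
  by rewrite leqNgt; apply/negP => loop2; apply: noloop2; exists i.
have [[l [l0 loopl]]|noloop] := EM (exists l, 0 < l /\ walks_to S p p l = 1).
  apply: growth_dichotomy_ext ext (growth_dichotomy_conv loop0 le1 l0 _ homH dH).
  elim=> [//|j IHj]; apply/eqP; rewrite eqn_leq le1 mulSn.
  by apply: leq_trans (walks_to_cat _ _ _ _ _); rewrite loopl IHj.
apply: growth_dichotomy_ext dH => m.
rewrite -ext big_ord_recl [walks_to S p p ord0]loop0 mul1n subn0 big1 ?addn0 // => i _.
suff -> : walks_to S p p (lift ord0 i) = 0 by [].
case: (posnP (walks_to S p p (lift ord0 i))) => // loop; exfalso; apply: noloop.
by exists (lift ord0 i); split=> //; apply/eqP; rewrite eqn_leq le1.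
Qed.

End Walks.

Section CountingReadableWords.
Variables (Q T : finType) (step : Q -> T -> option Q).

Fixpoint readable_words (q : Q) (m : nat) : seq (seq T) :=
  if m is m'.+1 then
    [seq x :: w | x <- enum T,
                  w <- if step q x is Some q' then readable_words q' m' else [::]]
  else [:: [::]].

Lemma mem_readable_words q m w :
  (w \in readable_words q m) = (size w == m) && readable step q w.
Proof.
elim: m q w => [|m IH] q w /=; first by case: w.
apply/allpairsPdep/idP => [[x [w' [_ w'q ->]]]|].
  by move: w'q => /=; case: (step q x) => // q'; rewrite IH eqSS.
case: w => // x w; rewrite /= eqSS => /andP[sw rw].
exists x, w; split=> //; first by rewrite mem_enum.
by case: (step q x) rw => // q' rw; rewrite IH sw.
Qed.

Lemma uniq_readable_words q m : uniq (readable_words q m).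
Proof.
elim: m q => //= m IH q; apply: allpairs_uniq_dep => [|x _|].
- exact: enum_uniq.
- by case: (step q x).
- by move=> [x w] [y w'] _ _ /= [-> ->].
Qed.

(** The matrix of the automaton: words read from [q] correspond to walks because
    the automaton is deterministic. *)
Definition step_count (q q' : Q) := #|[pred x | step q x == Some q']|.

Lemma size_readable_words q m :
  size (readable_words q m) = walks step_count [set: Q]%SET q m.
Proof.
elim: m q => [|m IH] q /=; first by rewrite inE.
rewrite inE size_allpairs_dep sumnE big_map big_enum /=.
under [RHS]eq_bigr => q' _ do rewrite /step_count -sum1_card big_distrl /= -IH mul1n.
rewrite (exchange_big_dep xpredT) //=; apply: eq_bigr => x _.
under eq_bigl => p do rewrite inE.
case: (step q x) => [q'|]; last by rewrite big_pred0.
by rewrite (big_pred1 q') // => p; rewrite /= eq_sym; apply/eqP/eqP => [[]|->].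
Qed.

Definition readable_upto q m := flatten [seq readable_words q j | j <- iota 0 m.+1].

Lemma mem_readable_upto q m w :
  (w \in readable_upto q m) = (size w <= m) && readable step q w.
Proof.
apply/flatten_mapP/andP => [[j]|[le rw]].
  by rewrite mem_iota mem_readable_words ltnS => /= jm /andP[/eqP-> ->].
by exists (size w); rewrite ?mem_iota ?ltnS // mem_readable_words eqxx.
Qed.

Lemma uniq_readable_upto q m : uniq (readable_upto q m).
Proof.
rewrite /readable_upto; elim: (iota 0 m.+1) (iota_uniq 0 m.+1) => //= j s IH /andP[js us].
rewrite cat_uniq uniq_readable_words IH // andbT; apply/hasPn => w.
case/flatten_mapP=> i si; rewrite !mem_readable_words => /andP[/eqP-> _].
by apply: contra js => /andP[/eqP<- _].
Qed.

Lemma size_readable_upto q m :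
  size (readable_upto q m) = walks_upto step_count [set: Q]%SET q m.
Proof.
rewrite size_flatten /shape -map_comp sumnE big_map /walks_upto.
rewrite -(big_mkord xpredT (walks _ _ _)) /index_iota subn0.
by apply: eq_bigr => j _ /=; rewrite size_readable_words.
Qed.

End CountingReadableWords.

(** * Reducing words by deletions and commutations *)

Lemma cat_cons_eq (T : Type) (p q a r : seq T) (t x : T) :
  p ++ t :: q = a ++ x :: r ->
  [\/ [/\ p = a, t = x & q = r],
      exists2 m, a = p ++ t :: m & q = m ++ x :: r |
      exists2 m, p = a ++ x :: m & r = m ++ t :: q].
Proof.
elim: p a => [|y p IH] [|z a] /=.
- by case=> -> ->; constructor 1.
- by case=> <- ->; constructor 2; exists a.
- by case=> -> <-; constructor 3; exists p.
case=> -> /IH[[-> -> ->]|[m -> ->]|[m -> ->]]; first by constructor 1.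
- by constructor 2; exists m.
- by constructor 3; exists m.
Qed.

Section Scan.
Variables (T : eqType) (e : rel T).

(** After the prefix [p], the bit says that [t] has occurred and that no letter
    read since its last occurrence is [e]-related to [t]. *)
Definition scan (t : T) (p : seq T) : bool :=
  foldl (fun b x => (x == t) || b && ~~ e x t) false p.

Lemma scan_rcons t p x : scan t (rcons p x) = (x == t) || scan t p && ~~ e x t.
Proof. by rewrite /scan -cats1 foldl_cat. Qed.

(** The witnessing occurrence of [t] is in [m], or it is in [p] and [m] contains
    no obstacle. *)
Lemma scan_cat t p m :
  scan t (p ++ m) = scan t m || scan t p && all (fun x => ~~ e x t) m.
Proof.
elim/last_ind: m => [|m x IH]; first by rewrite cats0 andbT.
rewrite -rcons_cat !scan_rcons IH all_rcons.
by case: (x == t); case: (e x t); rewrite /= ?andbF ?andbT ?orbF.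
Qed.

Lemma scan1 t x : scan t [:: x] = (x == t).
Proof. by rewrite /scan /= orbF. Qed.

Lemma scan_cons t x m :
  scan t (x :: m) = scan t m || (x == t) && all (fun x => ~~ e x t) m.
Proof. by rewrite -cat1s scan_cat scan1. Qed.

Lemma scanP t p : reflect
  (exists a m, p = a ++ t :: m /\ all (fun x => ~~ e x t) m) (scan t p).
Proof.
apply: (iffP idP) => [|[a [m [-> em]]]]; last first.
  by rewrite scan_cat scan_cons eqxx em !orbT.
elim/last_ind: p => [//|p x IH]; rewrite scan_rcons => /orP[/eqP->|].
  by exists p, [::]; rewrite cats1.
case/andP=> /IH[a [m [-> em]]] ext; exists a, (rcons m x).
by rewrite all_rcons em ext rcons_cat.
Qed.

Lemma scan_mem t m : scan t m -> t \in m.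
Proof. by case/scanP=> a [b [-> _]]; rewrite mem_cat inE eqxx orbT. Qed.

Lemma mem_scan t m : t \in m -> all (fun x => ~~ e x t) m -> scan t m.
Proof.
case/splitPr=> a b; rewrite all_cat => /= /and3P[_ _ eb].
by apply/scanP; exists a, b.
Qed.

Lemma scan_del t s p m : s != t -> scan t (p ++ s :: m) -> scan t (p ++ m).
Proof.
move=> st; rewrite !scan_cat scan_cons (negPf st) orbF /=.
by case/orP=> [->//|/andP[-> /andP[_ ->]]]; rewrite orbT.
Qed.

(** Commuting letters do not obstruct each other, and obstacles for a third
    letter count the same in either order. *)
Lemma scan_swap t a x y b : x != y -> ~~ e x y -> ~~ e y x ->
  scan t (a ++ x :: y :: b) = scan t (a ++ y :: x :: b).
Proof.
move=> xy exy eyx; rewrite !scan_cat !scan_cons /=.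
case: (eqVneq y t) => [<-|yt].
  by rewrite (negPf xy) exy /= !orbF; case: (e y y).
case: (eqVneq x t) => [<-|xt] /=; first by rewrite eyx !orbF; case: (e x x).
by case: (e x t); case: (e y t).
Qed.

End Scan.

Section HeckeKiselmanWords.
Variables (n : nat) (Theta : oriented_graph n).
Implicit Types (u v w p q a b m : word 'I_n) (s t x y : 'I_n).

Definition indep x y := [&& x != y, ~~ Theta x y & ~~ Theta y x].

Lemma indepC x y : indep x y = indep y x.
Proof. by rewrite /indep eq_sym; congr (_ && _); rewrite andbC. Qed.

Variant swap : word 'I_n -> word 'I_n -> Prop :=
  Swap a x y b of indep x y : swap (a ++ x :: y :: b) (a ++ y :: x :: b).

(** Equality in the partially commutative monoid (the trace monoid) of the
    unconnected pairs of letters. *)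
Inductive trace_eq u : word 'I_n -> Prop :=
| trace_refl : trace_eq u u
| trace_step v w : trace_eq u v -> swap v w -> trace_eq u w.

Lemma swap_sym u v : swap u v -> swap v u.
Proof. by case=> a x y b xy; apply: Swap; rewrite indepC. Qed.

Lemma swap_trace u v : swap u v -> trace_eq u v.
Proof. exact: trace_step (trace_refl u). Qed.

Lemma trace_trans v u w : trace_eq u v -> trace_eq v w -> trace_eq u w.
Proof. by move=> uv; elim=> // v' w' _ uv' /(trace_step uv'). Qed.

Lemma trace_sym u v : trace_eq u v -> trace_eq v u.
Proof.
elim=> [|v' w' _ IH /swap_sym/swap_trace]; first exact: trace_refl.
by move/trace_trans; apply.
Qed.

Lemma swap_cat a b u v : swap u v -> swap (a ++ u ++ b) (a ++ v ++ b).
Proof.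
by case=> a' x y b' xy; rewrite -!catA !(catA a) /=; apply: Swap.
Qed.

Lemma trace_cat a b u v : trace_eq u v -> trace_eq (a ++ u ++ b) (a ++ v ++ b).
Proof.
elim=> [|v' w' _ IH /(swap_cat a b)]; first exact: trace_refl.
exact: trace_step.
Qed.

Lemma trace_size u v : trace_eq u v -> size u = size v.
Proof. by elim=> // v' w' _ -> [a x y b _]; rewrite !size_cat. Qed.

Lemma trace_move a m t b : all (indep t) m ->
  trace_eq (a ++ t :: m ++ b) (a ++ m ++ t :: b).
Proof.
elim: m a => [|x m IH] a /=; first by move=> _; apply: trace_refl.
case/andP=> tx tm; apply: trace_trans (swap_trace (Swap _ _ tx)) _.
by rewrite -!(cat_rcons x); apply: IH.
Qed.

(** The relations are stable under reversing words and arrows at the same time;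
    a right-hand deletion is a left-hand one in the reversed word. *)
Definition opgraph : rel 'I_n := fun x y => Theta y x.

Definition deletable p t q := scan Theta t p || scan opgraph t (rev q).

Variant del : word 'I_n -> word 'I_n -> Prop :=
  Del p t q of deletable p t q : del (p ++ t :: q) (p ++ q).

Lemma del_size u v : del u v -> size u = (size v).+1.
Proof. by case=> p t q _; rewrite !size_cat addnS. Qed.

Lemma deletable_cat p t q a b : deletable p t q -> deletable (a ++ p) t (q ++ b).
Proof.
by case/orP=> h; rewrite /deletable ?rev_cat !scan_cat h ?orbT.
Qed.

Lemma del_cat a b u v : del u v -> del (a ++ u ++ b) (a ++ v ++ b).
Proof.
case=> p t q d; rewrite -!catA !(catA a) /=; apply: Del.
exact: deletable_cat.
Qed.

(** Commutations do not change which occurrences are deletable. *)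
Lemma swap_del u u' v : swap u u' -> del u v ->
  exists2 v', del u' v' & trace_eq v v'.
Proof.
case=> a x y b xy; have /and3P[nxy exy eyx] := xy.
move eqw: (a ++ x :: y :: b) => w dw; case: dw eqw => p t q d eqw.
have := cat_cons_eq (esym eqw); clear eqw.
have nyx : y != x by rewrite eq_sym.
case=> [[eqa eqx eqq]|[m eqa eqq]|[m eqp eqb]].
(* The deleted occurrence is the first letter of the swap, lies before the
   swap, or (below) is its second letter or lies after it. *)
- subst a x q; exists (p ++ y :: b); last exact: trace_refl.
  rewrite -!(cat_rcons y); apply: Del.
  move: d; rewrite /deletable scan_rcons (negPf nyx) /= eyx andbT.
  by rewrite rev_cons scan_rcons (negPf nyx) /opgraph exy andbT.
- subst a q; exists (p ++ m ++ y :: x :: b).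
    rewrite -catA /=; apply: Del.
    move: d; rewrite /deletable !rev_cat !rev_cons -!cats1 -!catA /=.
    by rewrite (@scan_swap _ opgraph _ (rev b) y x).
  by rewrite !catA; apply/swap_trace/Swap.
subst p; case: m eqb d => [|z m] /= [].
  move=> eqy eqb d; subst y b.
  exists (a ++ x :: q); last by rewrite cats1 cat_rcons; apply: trace_refl.
  apply: Del; move: d; rewrite /deletable cats1 scan_rcons (negPf nxy) exy andbT.
  by rewrite rev_cons scan_rcons (negPf nxy) /= /opgraph eyx andbT.
move=> eqz eqb d; subst z b; exists (a ++ y :: x :: m ++ q).
  rewrite -[y :: x :: _]/((y :: x :: m) ++ _) catA.
  rewrite -[y :: x :: m ++ q]/((y :: x :: m) ++ _) catA; apply: Del.
  by move: d; rewrite /deletable (scan_swap _ _ _ nxy).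
by rewrite -catA; apply/swap_trace/Swap.
Qed.

Lemma trace_del u u' v : trace_eq u u' -> del u v ->
  exists2 v', del u' v' & trace_eq v v'.
Proof.
move=> uu' uv; elim: uu' => [|x y _ [v' xv' vv'] /swap_del/(_ xv')[w yw v'w]].
  by exists v => //; apply: trace_refl.
by exists w => //; apply: trace_trans v'w.
Qed.

(** Deleting a letter can only remove obstacles for the other letters, so two
    deletions only interact when they concern the same letter [s]. If each one
    was justified by the other occurrence, the factor [m] in between contains no
    obstacle on either side, hence commutes with [s] when [s] is not in [m], and
    it does not matter which of the two occurrences of [s] survives. *)
Lemma del_diamond_split p s m t q :
  deletable p s (m ++ t :: q) -> deletable (p ++ s :: m) t q ->
  trace_eq (p ++ m ++ t :: q) (p ++ s :: m ++ q) \/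
  exists2 w, del (p ++ m ++ t :: q) w & del (p ++ s :: m ++ q) w.
Proof.
move=> ds dt.
suff [[ds' dt']|] : (deletable p s (m ++ q) /\ deletable (p ++ m) t q) \/
    (s = t /\ all (indep s) m).
- by right; exists (p ++ m ++ q); [rewrite !catA; apply: Del | apply: Del].
- by case=> <- sm; left; apply/trace_sym/trace_move.
case: (eqVneq s t) ds dt => [<-|st ds dt]; last first.
  left; split; last first.
    by case/orP: dt => [/(scan_del st) h|h]; rewrite /deletable h ?orbT.
  case/orP: ds => [h|]; first by rewrite /deletable h.
  rewrite /deletable !rev_cat rev_cons cat_rcons => /scan_del-> //.
    by rewrite orbT.
  by rewrite eq_sym.
rewrite /deletable !rev_cat !rev_cons cat_rcons !scan_cat !scan_cons eqxx /=.
rewrite /opgraph !arrow_irreflexive /= !all_rev.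
(* [lm] and [rm]: the witness is found inside [m], from the right or from the
   left; [al] and [ar]: no arrow from [s] into [m], resp. from [m] into [s]. *)
set lm := scan Theta s m; set rm := scan _ s (rev m).
set al := all _ m; set ar := all _ m; set rq := scan _ s (rev q).
case: (boolP (scan Theta s p)) => lp /=.
  by move=> _ /orP[/orP[/orP[->|->]|->]|->]; rewrite ?orbT; left.
case: (boolP rq) => /= rqE; first by rewrite !orbT => /orP[/orP[->|->]|->]; rewrite ?orbT; left.
rewrite !orbF => hr hl.
(* An occurrence of [s] in [m] takes over the role of a deleted one. *)
case: (boolP (s \in m)) => sm.
  left; split.
    by case/orP: hr => // hr; apply: mem_scan; rewrite ?mem_rev ?all_rev.
  by case/orP: hl => // hl; apply: mem_scan.
right; split=> //.
have {}hr : al by case/orP: hr => // /scan_mem; rewrite mem_rev (negPf sm).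
have {}hl : ar by case/orP: hl => // /scan_mem; rewrite (negPf sm).
apply/allP=> x xm; rewrite /indep (allP hr) // (allP hl) // !andbT.
by apply: contraNneq sm => ->.
Qed.

Lemma del_diamond u a b : del u a -> del u b ->
  trace_eq a b \/ exists2 w, del a w & del b w.
Proof.
case=> p s r ds; move eqw: (p ++ s :: r) => w dw; case: dw eqw => p' t r' dt eqw.
have := cat_cons_eq eqw; clear eqw; case=> [[-> _ ->]|[m eqp eqr]|[m eqp eqr]].
- by left; apply: trace_refl.
- by subst p' r; rewrite -catA; apply: del_diamond_split.
- subst p r'; rewrite -catA.
  case: (del_diamond_split dt ds) => [/trace_sym|[c]]; first by left.
  by right; exists c.
Qed.

Definition del_irr u := forall v, ~ del u v.

Inductive del_nf u : word 'I_n -> Prop :=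
| nf_irr : del_irr u -> del_nf u u
| nf_del v w : del u v -> del_nf v w -> del_nf u w.

Lemma del_nf_exists u : exists v, del_nf u v.
Proof.
have [k le_k] := ubnP (size u); elim: k => // k IH in u le_k *.
have [[v uv]|irr] := EM (exists v, del u v).
  have [|w vw] := IH v; first by rewrite -ltnS -(del_size uv).
  by exists w; apply: nf_del vw.
by exists u; apply: nf_irr => v uv; apply: irr; exists v.
Qed.

Lemma del_nf_size u v : del_nf u v -> (size v <= size u)%N /\ (size v = size u -> u = v).
Proof.
elim=> // {u v} u v w uv _ [le _]; rewrite (del_size uv).
by split; [apply: leqW | move=> eqs; rewrite eqs ltnn in le].
Qed.

(** Church-Rosser modulo commutations: the usual Newman argument by induction on
    the length, with equality replaced by [trace_eq]. *)
Lemma del_nf_unique u u' v v' :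
  trace_eq u u' -> del_nf u v -> del_nf u' v' -> trace_eq v v'.
Proof.
have [k le_k] := ubnP (size u); elim: k => // k IH in u u' v v' le_k *.
move=> uu' uv; case: uv le_k => [irr _|a w ua aw le_k] u'v'.
  case: u'v' => // a w /(trace_del (trace_sym uu'))[b /irr//].
have [b u'b ab] := trace_del uu' ua.
have lt_a : (size a < k)%N by rewrite -ltnS -(del_size ua).
case: u'v' => [irr|a' w' u'a' a'w']; first by case: (irr b).
have [ba'|[c bc a'c]] := del_diamond u'b u'a'.
  by apply: IH lt_a (trace_trans ab ba') aw a'w'.
have [z cz] := del_nf_exists c.
apply: (trace_trans (v := z)).
  by apply: IH lt_a ab aw (nf_del bc cz).
apply: IH (trace_refl a') (nf_del a'c cz) a'w'.
by rewrite -ltnS -(del_size u'a') -(trace_size uu').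
Qed.

Definition same_nf u v := forall u' v', del_nf u u' -> del_nf v v' -> trace_eq u' v'.

Lemma same_nf_trans v u w : same_nf u v -> same_nf v w -> same_nf u w.
Proof.
move=> uv vw u' w' uu' ww'; have [v' vv'] := del_nf_exists v.
exact: trace_trans (uv _ _ uu' vv') (vw _ _ vv' ww').
Qed.

Lemma del_same_nf u v : del u v -> same_nf u v.
Proof.
by move=> uv u' v' uu' /(nf_del uv); apply: del_nf_unique (trace_refl u) uu'.
Qed.

(** Every defining relation is a commutation or a single deletion; the contexts
    [a] and [b] make the induction pass through products. *)
Lemma hk_congr_same_nf u v : hk_congr Theta u v -> same_nf u v.
Proof.
move=> uv; suff /(_ [::] [::]) : forall a b, same_nf (a ++ u ++ b) (a ++ v ++ b).
  by rewrite /= !cats0.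
elim: uv => {u v} [u v uv|u|u v _ IH|u v w _ IHu _ IHv|u u' v v' _ IHu _ IHv] a b.
- case: uv => [i|i j ij ji|i j ij|i j ij].
  + apply/del_same_nf/del_cat; apply: (Del (p := [::]) (t := i) (q := [:: i])).
    by rewrite /deletable /= scan1 eqxx.
  + have [<-|nij] := eqVneq i j.
      by move=> u' v'; apply: del_nf_unique; apply: trace_refl.
    move=> u' v'; apply: del_nf_unique; apply/trace_cat/swap_trace.
    by apply: (Swap [::] [::]); rewrite /indep nij ij ji.
  + apply/del_same_nf/del_cat; apply: (Del (p := [:: i; j]) (t := i) (q := [::])).
    by rewrite /deletable /scan /= eqxx (arrow_asymmetric ij) orbT.
  + apply/del_same_nf/del_cat; apply: (Del (p := [::]) (t := j) (q := [:: i; j])).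
    by rewrite /deletable /scan /= eqxx /opgraph (arrow_asymmetric ij) orbT.
- by move=> u' v'; apply: del_nf_unique; apply: trace_refl.
- by move=> u' v' uu' vv'; apply: trace_sym (IH _ _ _ _ vv' uu').
- exact: same_nf_trans (IHu a b) (IHv a b).
- apply: (same_nf_trans (v := a ++ (u' ++ v) ++ b)).
    by have := IHu a (v ++ b); rewrite !catA.
  by have := IHv (a ++ u') b; rewrite !catA.
Qed.

Lemma swap_congr u v : swap u v -> hk_congr Theta u v.
Proof.
case=> a x y b /and3P[_ xy yx].
apply: hk_congr_cat; first exact: hk_congr_refl.
exact: (hk_congr_cat (hk_congr_rel (hk_comm xy yx)) (hk_congr_refl Theta b)).
Qed.

Lemma trace_congr u v : trace_eq u v -> hk_congr Theta u v.
Proof.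
elim=> [|v' w' _ IH /swap_congr]; first exact: hk_congr_refl.
exact: hk_congr_trans.
Qed.

Lemma congr_rcons u v x : hk_congr Theta u v -> hk_congr Theta (rcons u x) (rcons v x).
Proof. by move=> uv; rewrite -!cats1; apply: hk_congr_cat (hk_congr_refl _ _). Qed.

Lemma congr_cons u v x : hk_congr Theta u v -> hk_congr Theta (x :: u) (x :: v).
Proof.
by move=> uv; exact: (hk_congr_cat (hk_congr_refl Theta [:: x]) uv).
Qed.

(** The new [t] commutes with the last letter [x], or there is an arrow from [t] to
    [x]; in the second case [p x t = p t x t = p t x = p x], because [p] absorbs
    [t] by induction. *)
Lemma scan_congr p t : scan Theta t p -> hk_congr Theta (rcons p t) p.
Proof.
elim/last_ind: p => // p x IH; rewrite scan_rcons.
have ctx q r : hk_relation Theta q r -> hk_congr Theta (p ++ q) (p ++ r).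
  by move=> qr; apply: hk_congr_cat (hk_congr_refl _ _) (hk_congr_rel qr).
have [<- _|xt] := eqVneq x t.
  by rewrite -!cats1 -catA; apply/ctx/hk_idem.
case/andP=> /IH{}IH xt'; rewrite -!cats1 -catA /=.
have px : hk_congr Theta (p ++ [:: t; x]) (p ++ [:: x]).
  by rewrite -(cat_rcons t) !cats1; apply: congr_rcons.
have [tx|tx] := boolP (Theta t x); last exact: hk_congr_trans (ctx _ _ (hk_comm xt' tx)) px.
apply: hk_congr_trans px; apply: hk_congr_trans (ctx _ _ (hk_iji tx)).
rewrite -(cat_rcons t p [:: x; t]).
exact: hk_congr_cat (hk_congr_sym IH) (hk_congr_refl _ _).
Qed.

Lemma scan_op_congr q t : scan opgraph t (rev q) -> hk_congr Theta (t :: q) q.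
Proof.
elim: q => // x q IH; rewrite rev_cons scan_rcons.
have ctx a b : hk_relation Theta a b -> hk_congr Theta (a ++ q) (b ++ q).
  by move=> ab; apply: hk_congr_cat (hk_congr_rel ab) (hk_congr_refl _ _).
have [<- _|xt] := eqVneq x t; first exact: ctx _ _ (hk_idem _ _).
rewrite /opgraph; case/andP=> /IH/(congr_cons x) qx tx'.
have [xt'|xt'] := boolP (Theta x t); last exact: hk_congr_trans (ctx _ _ (hk_comm tx' xt')) qx.
apply: hk_congr_trans (hk_congr_sym (congr_cons t qx)) _.
exact: hk_congr_trans (ctx _ _ (hk_jij xt')) qx.
Qed.

Lemma del_congr u v : del u v -> hk_congr Theta u v.
Proof.
case=> p t q /orP[/scan_congr|/scan_op_congr] h.
  by rewrite -cat_rcons; apply: hk_congr_cat h (hk_congr_refl _ _).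
exact: hk_congr_cat (hk_congr_refl _ _) h.
Qed.

End HeckeKiselmanWords.

(** * The deg-lex order and minimal words *)

Section DegLexOrder.
Variables (T : choiceType) (r : rel T).
Hypothesis r_total : total_order_rel r.

Lemma order_refl : reflexive r.
Proof. by case: r_total => _ _ tot x; have := tot x x; rewrite orbb. Qed.

Lemma deglex_refl : reflexive (deglex r).
Proof.
by move=> u; rewrite /deglex ltnn eqxx /=; elim: u => //= x u ->; rewrite order_refl eqxx.
Qed.

Lemma lexle_trans : transitive (lexle r).
Proof.
case: r_total => anti trans _.
elim=> [|y v IH] [|x u] [|z w] //= /andP[xy uv] /andP[yz vw].
rewrite (trans y) //=; apply/implyP=> /eqP xz; subst z.
have eqxy : x = y by apply: anti; rewrite xy yz.
by subst y; apply: IH; [move: uv | move: vw]; rewrite eqxx.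
Qed.

Lemma lexle_total u v : lexle r u v || lexle r v u.
Proof.
case: r_total => anti _ tot; elim: u v => [|x u IH] [|y v] //=.
have [<-|xy] := eqVneq x y; last by rewrite !andbT; apply: tot.
by have := tot x x; rewrite orbb => -> /=.
Qed.

Lemma deglex_trans : transitive (deglex r).
Proof.
move=> v u w; rewrite /deglex.
case/orP=> [uv|/andP[/eqP-> uv]]; case/orP=> [vw|/andP[/eqP<- vw]].
- by rewrite (ltn_trans uv vw).
- by rewrite uv.
- by rewrite vw.
- by rewrite eqxx (lexle_trans uv vw) orbT.
Qed.

Lemma deglex_total : total (deglex r).
Proof.
move=> u v; rewrite /deglex; have [||_] := ltngtP (size u) (size v); rewrite ?orbT //.
exact: lexle_total.
Qed.

Lemma lexle_anti u v : lexle r u v -> lexle r v u -> u = v.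
Proof.
case: r_total => anti _ _; elim: u v => [|x u IH] [|y v] //=.
case/andP=> xy uv /andP[yx vu]; have eqxy : x = y by apply: anti; rewrite xy yx.
by subst y; rewrite (IH v) //; [move: uv | move: vu]; rewrite eqxx.
Qed.

Lemma deglex_anti u v : deglex r u v -> deglex r v u -> u = v.
Proof.
rewrite /deglex; have [||_] := ltngtP (size u) (size v); rewrite //=.
exact: lexle_anti.
Qed.

Lemma deglex_size u v : deglex r u v -> (size u <= size v)%N.
Proof. by case/orP=> [/ltnW//|/andP[/eqP->]]. Qed.

End DegLexOrder.

Section MinimalWords.
Variables (n : nat) (Theta : oriented_graph n) (r : rel 'I_n).
Hypothesis r_total : total_order_rel r.
Implicit Types (u v w p q a b m : word 'I_n) (s t x y : 'I_n).

Definition hk_minimal u := forall v, hk_congr Theta u v -> deglex r v u -> v = u.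

Lemma lexle_cat a u v : lexle r (a ++ u) (a ++ v) = lexle r u v.
Proof. by elim: a => //= x a ->; rewrite (order_refl r_total) eqxx. Qed.

(** Some word equal to [w] up to commutations begins with [y]: the first
    occurrence of [y] can travel to the front. *)
Fixpoint leads y w :=
  if w is x :: w' then (x == y) || indep Theta x y && leads y w' else false.

Lemma leads_trace y u v : trace_eq Theta u v -> leads y u -> leads y v.
Proof.
elim=> // v' w' _ IH vw /IH {IH}; case: vw => a p q b pq.
elim: a => [|x a IH] /=; last first.
  by case: (x == y) => //= /andP[-> /IH].
case: (eqVneq p y) => [<-|py] /=; last first.
  case/andP=> py' /orP[->//|/andP[-> ->]]; by rewrite py' orbT.
by rewrite indepC pq orbT.
Qed.

Lemma leadsP y w : leads y w ->
  exists m q, w = m ++ y :: q /\ all (fun x => indep Theta x y) m.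
Proof.
elim: w => //= x w IH /orP[/eqP->|/andP[xy /IH[m [q [-> my]]]]].
  by exists [::], w.
by exists (x :: m), q; rewrite /= xy.
Qed.

(** Removing the first occurrence of a letter respects commutations because it
    never overtakes another occurrence of itself; this makes the trace monoid
    cancellative. *)
Lemma trace_rem x u v :
  trace_eq Theta u v -> trace_eq Theta (rem x u) (rem x v).
Proof.
elim=> [|v' w' _ IH vw]; first exact: trace_refl.
apply: (trace_trans IH) => {IH}; case: vw => a p q b pq.
elim: a => [|y a IH] /=.
  case: (eqVneq p x) => [px|px]; case: (eqVneq q x) => [qx|qx].
  - by rewrite px qx; apply: trace_refl.
  - exact: trace_refl.
  - exact: trace_refl.
  - exact/swap_trace/(Swap [::]).
case: ifP => _; first by apply/swap_trace/Swap.
by have := trace_cat [:: y] [::] IH; rewrite !cats0.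
Qed.

Lemma trace_cons_inj x u v : trace_eq Theta (x :: u) (x :: v) -> trace_eq Theta u v.
Proof. by move/(trace_rem x); rewrite /= eqxx. Qed.

(** A letter [t] that can travel left to a place in front of a larger letter. *)
Definition shiftable u := exists a x m t b,
  [/\ u = a ++ x :: m ++ t :: b, all (fun z => indep Theta z t) (x :: m) & r t x].

(** At the first place where [v] differs from [u], the smaller letter [y] of [v]
    leads what remains of [v], hence also what remains of [u]. *)
Lemma trace_lexle u v : trace_eq Theta u v -> lexle r v u -> v = u \/ shiftable u.
Proof.
elim: u v => [|x u IH] [|y v] uv; have := trace_size uv => // _.
  by left.
move=> /= /andP[ryx]; case: (eqVneq y x) uv => [->|yx] uv /=.
  move=> /(IH _ (trace_cons_inj uv))[->|[a [z [m [t [b [-> ind rtz]]]]]]].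
    by left.
  by right; exists (x :: a), z, m, t, b.
have : leads y (x :: u).
  by apply: leads_trace (trace_sym uv) _; rewrite /= eqxx.
case/leadsP=> -[|z m] [q [/= [xy ->] ind]]; first by rewrite xy eqxx in yx.
by right; exists [::], x, m, y, q; split=> //=; rewrite xy.
Qed.

(** Conversely, let [u] admit neither reduction. A smaller congruent word [v] has
    the same length as [u], because its reduced form is [u] up to commutations;
    so [v] is itself reduced and differs from [u] by commutations only. *)
Lemma minimalP u : hk_minimal u <-> del_irr Theta u /\ ~ shiftable u.
Proof.
split=> [min|[irr nsh] v uv].
  split=> [v uv|[a [x [m [t [b [uE ind rtx]]]]]]].
    have vu : v = u.
      by apply: min (del_congr uv) _; rewrite /deglex (del_size uv) ltnSn.
    by have := del_size uv; rewrite vu => /n_Sn.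
  have xt : t != x by case/andP: ind => /and3P[]; rewrite eq_sym.
  have eqtr : trace_eq Theta u (a ++ t :: (x :: m) ++ b).
    rewrite uE; apply: trace_sym; apply: (trace_move a (m := x :: m)).
    by apply: sub_all ind => z; rewrite indepC.
  have /eqP : a ++ t :: (x :: m) ++ b = u.
    apply: min (trace_congr eqtr) _; rewrite /deglex -(trace_size eqtr) eqxx orbC.
    by rewrite uE lexle_cat /= rtx (negPf xt).
  by rewrite uE eqseq_cat // eqxx /= eqseq_cons (negPf xt).
have [v' vv'] := del_nf_exists Theta v; have [le eqv] := del_nf_size vv'.
have uv' := hk_congr_same_nf uv (nf_irr irr) vv'; have su := trace_size uv'.
rewrite /deglex => /orP[|/andP[/eqP svu lex]].
  by rewrite ltnNge su le.
have vE : v = v' by apply: eqv; rewrite svu.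
by case: (trace_lexle (u := u) (v := v)) => //; rewrite vE.
Qed.

(** After the prefix [p], the bit says that a following [t] could travel back to
    a place in front of a larger letter. *)
Definition shift_scan t p := foldl (fun f x => indep Theta x t && (r t x || f)) false p.

Lemma shift_scanP t p : reflect (exists a x m,
  [/\ p = a ++ x :: m, all (fun z => indep Theta z t) (x :: m) & r t x])
  (shift_scan t p).
Proof.
apply: (iffP idP) => [|[a [x [m [-> ind rtx]]]]].
  elim/last_ind: p => // p x IH; rewrite /shift_scan -cats1 foldl_cat /=.
  case/andP=> xt /orP[rtx|/IH[a [y [m [-> ind rty]]]]].
    by exists p, x, [::]; rewrite /= xt.
  exists a, y, (m ++ [:: x]); rewrite -catA; split=> //.
  by rewrite all_cat /= xt !andbT.
rewrite /shift_scan foldl_cat /= rtx; case/andP: ind => -> /=.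
by elim: m => //= y m IH /andP[-> /IH]; rewrite orbT.
Qed.

Definition hk_flag : finType := (bool * bool * bool)%type.

Definition hk_upd t (f : hk_flag) x : hk_flag :=
  ((x == t) || f.1.1 && ~~ Theta x t,
   (x == t) || f.1.2 && ~~ Theta t x,
   indep Theta x t && (r t x || f.2)).

Definition hk_bad (f : hk_flag) := [|| f.1.1, f.1.2 | f.2].

Lemma hk_flagE t p : foldl (hk_upd t) (false, false, false) p =
  (scan Theta t p, scan (opgraph Theta) t p, shift_scan t p).
Proof.
elim/last_ind: p => // p x IH.
by rewrite !scan_rcons /shift_scan -cats1 !foldl_cat /= IH.
Qed.

(** The left one of two equal letters is deletable when nothing obstructs it up to
    the right one. An automaton detects this on reaching the right one. *)
Lemma opscan_split u :
  (exists p t q, u = p ++ t :: q /\ scan (opgraph Theta) t (rev q)) <->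
  (exists p t q, u = p ++ t :: q /\ scan (opgraph Theta) t p).
Proof.
split=> -[p [t [q [-> /scanP[a [m [E em]]]]]]].
  exists (p ++ t :: rev m), t, (rev a); split.
    by rewrite -(revK q) E rev_cat rev_cons cat_rcons -catA.
  by apply/scanP; exists p, (rev m); rewrite all_rev.
exists a, t, (m ++ t :: q); split; first by rewrite E -catA.
by apply/scanP; exists (rev q), (rev m); rewrite all_rev rev_cat rev_cons cat_rcons.
Qed.

Definition hk_state := {ffun 'I_n -> hk_flag}.

Definition hk_step : hk_state -> 'I_n -> option hk_state := flag_step hk_upd hk_bad.

Definition hk_start : hk_state := [ffun=> (false, false, false)].

Lemma readable_minimal u : readable hk_step hk_start u <-> hk_minimal u.
Proof.
rewrite readable_flags minimalP.
under eq_forall => p do under eq_forall => t do under eq_forall => q do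
  rewrite ffunE hk_flagE /hk_bad /=.
split=> [good|[irr nsh] p t q uE].
  split=> [v uv|[a [x [m [t [b [uE ind rtx]]]]]]].
    case: uv good => p t q /orP[sc|sc] good.
      by have := good p t q erefl; rewrite sc.
    have [|p' [t' [q' [/good]]]] := (opscan_split (p ++ t :: q)).1.
      by exists p, t, q.
    by move=> + sc'; rewrite sc' orbT.
  have /shift_scanP sh : exists a' x' m', [/\ a ++ x :: m = a' ++ x' :: m',
      all (fun z => indep Theta z t) (x' :: m') & r t x'] by exists a, x, m.
  by have := good (a ++ x :: m) t b; rewrite sh !orbT uE -catA => /(_ erefl).
apply/negP=> /or3P[sc|sc|/shift_scanP[a [x [m [pE ind rtx]]]]].
- by apply: (irr (p ++ q)); rewrite uE; apply: Del; rewrite /deletable sc.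
- have [|p' [t' [q' [uE' sc']]]] := (opscan_split u).2; first by exists p, t, q.
  by apply: (irr (p' ++ q')); rewrite uE'; apply: Del; rewrite /deletable sc' orbT.
- by apply: nsh; exists a, x, m, t, q; rewrite uE pE -catA.
Qed.

End MinimalWords.

Section NormalForms.
Variables (n : nat) (Theta : oriented_graph n) (r : rel 'I_n).
Hypothesis r_total : total_order_rel r.
Implicit Types (u v w : word 'I_n).

Lemma minimal_exists u :
  exists v, [/\ hk_congr Theta u v, (size v <= size u)%N & hk_minimal Theta r v].
Proof.
pose W := (size u).-bseq 'I_n.
pose P : pred W := fun w : W => `[< hk_congr Theta u (w : word 'I_n) >].
pose u0 : W := Bseq (leqnn (size u)).
have Pu0 : P u0 by apply/asboolP; apply: hk_congr_refl.
have := extremumP (fun w : W => (w : word 'I_n)) (deglex_refl r_total)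
  (deglex_trans r_total) (deglex_total r_total) Pu0.
case=> w /asboolP uw minw; exists w; split=> // [|v wv vw]; first exact: size_bseq.
have vu : (size v <= size u)%N.
  exact: leq_trans (deglex_size vw) (size_bseq w).
have wv' : deglex r w v.
  by apply: (minw (Bseq vu)); apply/asboolP; apply: hk_congr_trans uw wv.
exact: deglex_anti vw wv'.
Qed.

(** Least words are a transversal of the classes, the order being total. *)
Lemma minimal_unique u v : hk_minimal Theta r u -> hk_minimal Theta r v ->
  hk_class Theta u = hk_class Theta v -> u = v.
Proof.
move=> minu minv /hk_classP uv; have [vu|uv'] := orP (deglex_total r_total v u).
  by rewrite (minu v).
by rewrite (minv u) //; apply: hk_congr_sym.
Qed.

End NormalForms.

Import Order.TTheory GRing.Theory Num.Theory.
Local Open Scope ring_scope.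

(** * Normal words of the Hecke-Kiselman algebra *)

Section NormalWordsMinimal.
Variables (k : fieldType) (n : nat) (Theta : oriented_graph n) (r : rel 'I_n).
Hypothesis r_total : total_order_rel r.
Implicit Types (u v w : word 'I_n).

Lemma hk_proj_coef (f : {malg k[word 'I_n]}) (x : HK Theta) :
  (hk_proj Theta f)@_x = \sum_(v <- msupp f) f@_v * (hk_class Theta v == x)%:R.
Proof.
rewrite /hk_proj mmapE raddf_sum /=; apply: eq_bigr => v _.
by rewrite mcoeffCM mcoeffU1.
Qed.

(** If [v] is congruent to [w] and smaller, [w] leads [w - v]. If [w] leads an
    element of the kernel, the coefficients on the class of [w] sum to zero, so
    the support contains another, hence smaller, word of that class. *)
Lemma normal_minimal w :
  normal_words r (@hk_proj k n Theta) w <-> hk_minimal Theta r w.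
Proof.
split=> [norm v wv vw|min [f [_ pf0 [wf fw]]]].
  apply: contrapT => vnw; apply: norm; exists (<< w >> - << v >>).
  have vw0 : (v == w) = false by apply/eqP.
  have wsupp : w \in msupp (<< w >> - << v >> : {malg k[word 'I_n]}).
    by rewrite -mcoeff_neq0 mcoeffB !mcoeffU1 eqxx vw0 subr0 oner_neq0.
  split.
  - by apply: contraTneq wsupp => ->; rewrite msupp0.
  - by rewrite raddfB /= !hk_proj_word ((hk_classP _ _ _).2 wv) subrr.
  split=> // x /(fsubsetP (msuppB_le _ _)).
  by rewrite !msuppU1 !inE => /orP[/eqP->|/eqP->] //; exact: deglex_refl.
have := hk_proj_coef f (hk_class Theta w); rewrite pf0 mcoeff0.
rewrite (big_fsetD1 w) //= eqxx mulr1 big1_fset ?addr0.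
  by move/esym/eqP; rewrite mcoeff_eq0 wf.
move=> v; rewrite !inE => /andP[vw vf] _.
case: eqP => [/esym/hk_classP wv|_]; last by rewrite mulr0.
by rewrite (min v wv (fw v vf)) eqxx in vw.
Qed.

Lemma hk_automaton : automaton_algebra r (@hk_proj k n Theta).
Proof.
rewrite /automaton_algebra.
suff -> : normal_words r (@hk_proj k n Theta) =
  [set w : word 'I_n | readable (hk_step Theta r) (hk_start n) w]%classic.
  exact: regular_readable.
apply/seteqP; split=> w /=.
  by move/normal_minimal/(readable_minimal _ r_total).
by move/(readable_minimal _ r_total)/normal_minimal.
Qed.

End NormalWordsMinimal.

(** * Dimensions of spans *)

Section LinearAlgebra.
Variables (k : fieldType) (V : lmodType k).
Implicit Types (s t : seq V) (S W : set V) (x y : V).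

Lemma lin_span_closed S W : W 0 ->
  (forall a x y, S x -> W y -> W (a *: x + y)) -> (lin_span S `<=` W)%classic.
Proof.
move=> W0 WD x [l lS ->]; elim: l lS => [|p l IH] lS; first by rewrite big_nil.
rewrite big_cons; apply: WD; first by apply: lS; rewrite inE eqxx.
by apply: IH => q ql; apply: lS; rewrite inE ql orbT.
Qed.

Lemma lin_span_sub S : (S `<=` lin_span S)%classic.
Proof.
move=> x Sx; exists [:: (1, x)]; last by rewrite big_seq1 scale1r.
by move=> p; rewrite inE => /eqP->.
Qed.

Lemma lin_span_mono S W : (S `<=` W)%classic -> (lin_span S `<=` lin_span W)%classic.
Proof. by move=> SW x [l lS ->]; exists l => // p /lS/SW. Qed.

Lemma lin_span_coords t x : lin_span [set` t]%classic x ->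
  exists c : 'rV[k]_(size t), x = \sum_j c 0 j *: t`_j.
Proof.
move: x; apply: lin_span_closed => [|a x _ /= xt [c ->]].
  by exists 0; rewrite big1 // => j _; rewrite mxE scale0r.
have xt' : (index x t < size t)%N by rewrite index_mem.
exists (a *: delta_mx 0 (Ordinal xt') + c).
under [RHS]eq_bigr => j _ do rewrite !mxE eqxx /= scalerDl.
rewrite big_split /=; congr (_ + _).
rewrite (bigD1 (Ordinal xt')) //= eqxx mulr1 nth_index // big1 ?addr0 // => j jx.
by rewrite (negPf jx) mulr0 scale0r.
Qed.

(** Otherwise the matrix of coordinates has more rows than columns, and a vector
    of its left kernel is a linear relation. *)
Lemma lin_indep_size_le s t : lin_indep s ->
  ([set` s] `<=` lin_span [set` t])%classic -> (size s <= size t)%N.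
Proof.
move=> ind st.
have /choice[c cP] (i : 'I_(size s)) :
    exists c : 'rV[k]_(size t), s`_i = \sum_j c 0 j *: t`_j.
  by apply/lin_span_coords/st => /=; apply: mem_nth.
pose M : 'M[k]_(size s, size t) := \matrix_i c i.
suff /eqP <- : row_free M by apply: rank_leq_col.
rewrite -kermx_eq0; apply: contraT => /rowV0Pn[u /sub_kermxP uM u0].
have [i ui] : exists i, u 0 i != 0.
  apply/existsP; apply: contraNT u0; rewrite negb_exists => /forallP u0.
  by apply/eqP/rowP=> i; rewrite mxE; apply/eqP; have := u0 i; rewrite negbK.
(* Linear independence quantifies over coefficients indexed by all of [nat]. *)
pose d (j : nat) := if insub j is Some j' then u 0 j' else 0.
have dE (j : 'I_(size s)) : d j = u 0 j by rewrite /d valK.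
case/eqP: ui; rewrite -dE; apply: ind => //.
under eq_bigr => j _ do rewrite dE cP scaler_sumr.
rewrite exchange_big big1 // => j _ /=.
under eq_bigr => i' _ do rewrite scalerA.
rewrite -scaler_suml; have /rowP/(_ j) := uM; rewrite !mxE => uMj.
rewrite [X in X *: _](_ : _ = 0) ?scale0r // -[RHS]uMj.
by apply: eq_bigr => i' _; rewrite mxE.
Qed.

Lemma subspace_dim_le W t : (W `<=` lin_span [set` t])%classic ->
  (subspace_dim W <= size t)%N.
Proof.
move=> Wt; rewrite /subspace_dim; case: xgetP => // _ -> [s [ind sW] <-].
apply: lin_indep_size_le ind _ => x xs; apply: Wt; rewrite -sW.
exact: lin_span_sub.
Qed.

Lemma subspace_dim_basis W s : is_basis W s -> subspace_dim W = size s.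
Proof.
move=> basis; apply/eqP; rewrite eqn_leq subspace_dim_le; last by case: basis => _ ->.
rewrite /subspace_dim; case: xgetP => [_ -> [t [_ tW] <-]|/(_ (size s))[]]; last by exists s.
case: basis => ind sW; apply: lin_indep_size_le ind _ => x xs.
by rewrite tW -sW; apply: lin_span_sub.
Qed.

End LinearAlgebra.

(** * Growth exponents as upper limits *)

Section GrowthExponent.
Variable R : realType.
Implicit Types (v : nat -> nat) (e : nat).

Definition log_ratio v (m : nat) : \bar R := (ln (v m)%:R / ln m%:R : R)%:E.

Lemma limn_esupE (u : nat -> \bar R) : limn_esup u = ereal_inf (range (esups u)).
Proof. by rewrite limn_esup_lim; apply/cvg_lim => //; exact: cvg_esups_inf. Qed.

Lemma ln_nat_ge0 m : 0 <= ln m%:R :> R.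
Proof. by case: m => [|m]; [rewrite ln0 | rewrite ln_ge0 // ler1n]. Qed.

Lemma ln_nat_large (b : R) : exists N, forall m, (N <= m)%N -> b <= ln m%:R.
Proof.
exists (Num.bound (expR b)).+1 => m le.
have lt : expR b < m%:R.
  apply: lt_le_trans (archi_boundP (expR_ge0 b)) _.
  by rewrite ler_nat; apply: leq_trans le.
by rewrite -[b]expRK ler_ln ?posrE ?expR_gt0 ?ltW // (lt_trans (expR_gt0 b)).
Qed.

Lemma ler_ln_nat p q : (p <= q)%N -> ln p%:R <= ln q%:R :> R.
Proof.
case: p => [|p] le; first by rewrite ln0 ?ln_nat_ge0.
by rewrite ler_ln ?posrE ?ltr0n ?ler_nat // (leq_trans _ le).
Qed.

Lemma lnM_nat p q : (0 < p)%N -> (0 < q)%N ->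
  ln (p * q)%N%:R = ln p%:R + ln q%:R :> R.
Proof. by move=> p0 q0; rewrite natrM lnM ?posrE ?ltr0n. Qed.

Lemma lnX_nat p e : (0 < p)%N -> ln (p ^ e)%N%:R = e%:R * ln p%:R :> R.
Proof. by move=> p0; rewrite natrX lnXn ?ltr0n // mulr_natl. Qed.

(** [ln (v m) / ln m] is at most [e + ln K / ln m], up to using [K.+1] to have a
    positive constant. *)
Lemma limn_esup_log_ratio_le v K e :
  (forall m, (0 < m)%N -> (v m <= K * m ^ e)%N) ->
  (limn_esup (log_ratio v) <= e%:R%:E)%E.
Proof.
move=> vK; apply/lee_addgt0Pr => d d0.
have [N Nln] := ln_nat_large (ln K.+1%:R / d + 1).
rewrite limn_esupE; apply: ereal_inf_le; exists (esups (log_ratio v) N); first by exists N.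
apply: ge_ereal_sup => _ [m /= Nm <-].
have {Nln} := Nln m Nm; set L := ln m%:R => leL.
have q0 : 0 <= ln K.+1%:R / d by rewrite divr_ge0 ?ln_nat_ge0 // ltW.
have L0 : 0 < L by lra.
have m0 : (0 < m)%N by rewrite lt0n; apply: contraTneq L0 => m0; rewrite /L m0 ln0 // ltxx.
rewrite /log_ratio lee_fin ler_pdivrMr // -/L.
have : ln (v m)%:R <= ln (K.+1 * m ^ e)%N%:R :> R.
  apply/ler_ln_nat/(leq_trans (vK m m0)); rewrite leq_mul2r leqnSn orbT //.
rewrite lnM_nat ?expn_gt0 ?m0 // lnX_nat // -/L => /le_trans; apply.
rewrite mulrDl addrC lerD2l -ler_pdivrMl // mulrC; lra.
Qed.

(** It suffices to evaluate along the multiples of [c]: there the ratio is at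
    least [(e * ln m - ln c) / (ln m + ln c)], which tends to [e]. *)
Lemma limn_esup_log_ratio_ge v c e : (0 < c)%N ->
  (forall m, (m.+1 ^ e <= c * v (c * m))%N) ->
  (e%:R%:E <= limn_esup (log_ratio v))%E.
Proof.
move=> c0 vc; apply/lee_addgt0Pr => d d0.
rewrite limn_esupE -leeBlDr //; apply: le_ereal_inf_tmp => _ [N _ <-].
have [M Mln] := ln_nat_large ((1 + e%:R) * ln c%:R / d + 1).
pose m := maxn N M.
have := Mln m (leq_maxr _ _); set L := ln m%:R => leL.
have lc : 0 <= ln c%:R :> R by exact: ln_nat_ge0.
have q0 : 0 <= (1 + e%:R) * ln c%:R / d.
  by rewrite divr_ge0 ?mulr_ge0 // ?addr_ge0 // ltW.
have L0 : 0 < L by lra.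
have m0 : (0 < m)%N by rewrite lt0n; apply: contraTneq L0 => m0; rewrite /L m0 ln0 // ltxx.
apply: (@le_trans _ _ (log_ratio v (c * m))); last first.
  apply: ereal_sup_ubound; exists (c * m)%N => //=.
  by apply: leq_trans (leq_maxl N M) _; rewrite leq_pmull.
rewrite /log_ratio -EFinB lee_fin lnM_nat // -/L.
rewrite ler_pdivlMr; last by rewrite ltr_wpDl.
have v0 : (0 < v (c * m))%N.
  have : (0 < c * v (c * m))%N by apply: leq_trans (vc m); rewrite expn_gt0.
  by rewrite muln_gt0 c0.
have : ln (m ^ e)%N%:R <= ln (c * v (c * m))%N%:R :> R.
  apply/ler_ln_nat/(leq_trans _ (vc m)).
  by have [->|e0] := posnP e; rewrite // leq_exp2r.
rewrite lnM_nat // lnX_nat // -/L.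
have : (1 + e%:R) * ln c%:R <= d * L.
  rewrite -ler_pdivrMl // mulrC; lra.
have : 0 <= d * ln c%:R by rewrite mulr_ge0 // ltW.
set a := ln (v _)%:R; set E := e%:R; set x := ln c%:R; nra.
Qed.

End GrowthExponent.

(** * The Gelfand-Kirillov dimension *)

Section HeckeKiselmanGrowth.
Variables (k : fieldType) (n : nat) (Theta : oriented_graph n).
Notation A := (hk_algebra k Theta).
Implicit Types (u v w : word 'I_n) (x y : A).

(** The dimension does not refer to an order on the generators; any one will do
    to select the normal words. *)
Definition ord_leq : rel 'I_n := fun i j => (i <= j)%N.

Lemma ord_leq_total : total_order_rel ord_leq.
Proof.
split; [|move=> ? ? ?; exact: leq_trans|move=> ? ?; exact: leq_total].
by move=> i j; rewrite /ord_leq -eqn_leq => /eqP/val_inj.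
Qed.

Definition normal_upto j : seq (word 'I_n) :=
  readable_upto (hk_step Theta ord_leq) (hk_start n) j.

Lemma normal_uptoP j w :
  w \in normal_upto j <-> (size w <= j)%N /\ hk_minimal Theta ord_leq w.
Proof.
rewrite mem_readable_upto; split.
  by case/andP=> -> /(readable_minimal _ ord_leq_total).
by case=> -> /(readable_minimal _ ord_leq_total).
Qed.

Definition normal_basis j : seq A := [seq hk_word_embed k Theta w | w <- normal_upto j].

(** The [j]-th term of the length filtration, described by supports so that it is
    visibly stable under linear combinations and products. *)
Definition length_le j : set A :=
  [set x : A | forall h, h \in msupp x ->
     exists2 w, (size w <= j)%N & h = hk_class Theta w]%classic.

Lemma length_leW i j x : (i <= j)%N -> length_le i x -> length_le j x.
Proof.
by move=> ij xi h /xi[w wi ->]; exists w => //; apply: leq_trans ij.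
Qed.

Lemma length_le_zero j : length_le j 0.
Proof. by move=> h; rewrite msupp0. Qed.

Lemma length_le_one j : length_le j 1.
Proof. by move=> h; rewrite msuppU1 inE => /eqP->; exists [::]. Qed.

Lemma length_leZD j a x y : length_le j x -> length_le j y -> length_le j (a *: x + y).
Proof.
move=> xj yj h /(fsubsetP (msuppD_le _ _)); rewrite inE => /orP[|/yj//].
by move/(fsubsetP (msuppZ_le _ _)) => /xj.
Qed.

Lemma length_leM i j x y : length_le i x -> length_le j y -> length_le (i + j) (x * y).
Proof.
move=> xi yj h /msuppM_le[h1 [h2 [/xi[u ui ->] /yj[v vj ->] ->]]].
exists (u ++ v); first by rewrite size_cat leq_add.
by rewrite hk_class_cat.
Qed.

Lemma length_le_prod j (s : seq A) : (forall x, x \in s -> length_le j x) ->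
  length_le (j * size s) (\prod_(x <- s) x).
Proof.
elim: s => [|x s IH] sj; first by rewrite big_nil; exact: length_le_one.
rewrite big_cons /= mulnS; apply: length_leM; first by apply: sj; rewrite inE eqxx.
by apply: IH => y ys; apply: sj; rewrite inE ys orbT.
Qed.

Lemma length_le_word w : length_le (size w) (hk_word_embed k Theta w).
Proof. by move=> h; rewrite msuppU1 inE => /eqP->; exists w. Qed.

Lemma span_length_le j (S : set A) : (S `<=` length_le j)%classic ->
  (lin_span S `<=` length_le j)%classic.
Proof.
move=> Sj; apply: lin_span_closed => [|a x y /Sj]; first exact: length_le_zero.
exact: length_leZD.
Qed.

(** Passing to the least word of a class does not increase the length. *)
Lemma span_normal_basis j : lin_span [set` normal_basis j]%classic = length_le j.
Proof.
apply/seteqP; split.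
  apply: span_length_le => x /= /mapP[w /normal_uptoP[wj _] ->].
  by apply: length_leW wj _; apply: length_le_word.
move=> x xj; exists [seq (x@_h, << h >>) | h <- msupp x]; last first.
  rewrite big_map [LHS]monalgE; apply: eq_bigr => h _ /=.
  by apply/malgP=> g; rewrite mcoeffU mcoeffZ mcoeffU1 mulr_natr.
move=> _ /mapP[h /xj[u uj ->] ->] /=.
have [w [uw wu minw]] := minimal_exists Theta ord_leq_total u.
rewrite ((hk_classP _ _ _).2 uw); apply/mapP; exists w => //.
by apply/normal_uptoP; split=> //; apply: leq_trans wu uj.
Qed.

Lemma mcoeff_word_embed (c : k) w h :
  mcoeff h (c *: hk_word_embed k Theta w) = c * (hk_class Theta w == h)%:R.
Proof. by rewrite mcoeffZ mcoeffU1. Qed.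

Lemma word_embed_indep (s : seq (word 'I_n)) : uniq (map (hk_class Theta) s) ->
  lin_indep (map (hk_word_embed k Theta) s).
Proof.
move=> us c; rewrite size_map => sum0 i si.
have := congr1 (mcoeff (hk_class Theta (nth [::] s i))) sum0.
rewrite mcoeff0 raddf_sum (bigD1 (Ordinal si)) //= (nth_map [::]) //.
rewrite [X in X + _ = _]mcoeff_word_embed.
rewrite eqxx mulr1 big1 ?addr0 // => l li.
rewrite (nth_map [::]) // mcoeff_word_embed.
rewrite -!(nth_map _ (hk_class Theta [::])) // nth_uniq ?size_map //.
by move: li; rewrite -val_eqE => /negPf ->; rewrite mulr0.
Qed.

Lemma normal_basis_indep j : lin_indep (normal_basis j).
Proof.
apply: word_embed_indep; rewrite map_inj_in_uniq ?uniq_readable_upto //.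
move=> u v /normal_uptoP[_ minu] /normal_uptoP[_ minv].
exact: (minimal_unique ord_leq_total minu minv).
Qed.

Lemma normal_basisP j : is_basis (length_le j) (normal_basis j).
Proof. by split; [exact: normal_basis_indep | exact: span_normal_basis]. Qed.

Lemma filtration_length_le (V : set A) j m : (V `<=` length_le j)%classic ->
  (filtration V m `<=` length_le (j * m))%classic.
Proof.
move=> Vj; apply: span_length_le => _ [s [sm sV] <-].
apply: (length_leW (i := j * size s)); first by rewrite leq_mul2l sm orbT.
by apply: length_le_prod => x /sV/Vj.
Qed.

(** The algebra is generated in length one. *)
Lemma filtration_letters m : filtration (length_le 1) m = length_le m.
Proof.
apply/seteqP; split; first by rewrite -[in length_le m](mul1n m); exact: filtration_length_le.
rewrite -span_normal_basis; apply: lin_span_mono.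
move=> x /= /mapP[w /normal_uptoP[wm _] ->].
exists [seq hk_word_embed k Theta [:: i] | i <- w].
  by split=> [|_ /mapP[i _ ->]]; [rewrite size_map | exact: (@length_le_word [:: i])].
rewrite big_map; elim: w {wm} => [|i w IH]; first by rewrite big_nil.
rewrite big_cons IH -[i :: w]cat1s.
by have [/(_ [:: i] w)] := hk_word_embed_mmorphism k Theta.
Qed.

Lemma growth_letters m : growth (length_le 1) m = size (normal_upto m).
Proof.
rewrite /growth filtration_letters (subspace_dim_basis (normal_basisP m)).
by rewrite size_map.
Qed.

Lemma growth_le (V : set A) j m : (V `<=` length_le j)%classic ->
  (growth V m <= size (normal_upto (j * m)))%N.
Proof.
move=> Vj; rewrite -(size_map (hk_word_embed k Theta)); apply: subspace_dim_le.
by rewrite span_normal_basis; apply: filtration_length_le.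
Qed.

Lemma findim_length_le (V : set A) : findim_subspace V ->
  exists j, (V `<=` length_le j)%classic.
Proof.
case=> s [_ <-].
suff [j sj] : exists j, forall x, x \in s -> length_le j x.
  by exists j; apply: span_length_le.
elim: s => [|x s [j sj]]; first by exists 0%N.
exists (maxn j (\max_(h <- msupp x) size (hk_repr h))) => y.
rewrite inE => /orP[/eqP->|/sj]; last by apply: length_leW; rewrite leq_maxl.
move=> h hx; exists (hk_repr h); last by rewrite hk_reprK.
apply: leq_trans (leq_maxr _ _).
by rewrite (big_fsetD1 h) //= leq_maxl.
Qed.

Lemma normal_growth_dichotomy : growth_dichotomy (fun m => size (normal_upto m)).
Proof.
have := walks_growth_dichotomy (step_count (hk_step Theta ord_leq))
  (finset.in_setT (hk_start n)).
by apply: growth_dichotomy_ext => m; rewrite size_readable_upto.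
Qed.

Variable R : realType.

Lemma hk_GKdim_ge e : poly_lower e (fun m => size (normal_upto m)) ->
  (e%:R%:E <= GKdim R A)%E.
Proof.
case=> c c0 lower.
apply: (@le_trans _ _ (limn_esup (log_ratio R (growth (length_le 1))))).
  by apply: (limn_esup_log_ratio_ge _ c0) => m; rewrite growth_letters.
apply: ereal_sup_ubound; exists (length_le 1) => //.
by exists (normal_basis 1); apply: normal_basisP.
Qed.

(** A subspace inside the [j]-th term of the length filtration grows at most like
    the normal words of length [j * m], which costs a factor [j.+1 ^ e]. *)
Lemma hk_GKdim_le e : poly_upper e (fun m => size (normal_upto m)) ->
  (GKdim R A <= e%:R%:E)%E.
Proof.
case=> C upper; apply: ge_ereal_sup => _ [V /findim_length_le[j Vj] <-].
apply: (@limn_esup_log_ratio_le _ _ (C * j.+1 ^ e)) => m m0.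
apply: leq_trans (growth_le m Vj) _; apply: leq_trans (upper _) _.
rewrite -mulnA leq_mul2l -expnMn; apply/orP; right.
have [->//|e0] := posnP e; rewrite leq_exp2r // mulSn addnC.
by rewrite -addn1 leq_add2l.
Qed.

End HeckeKiselmanGrowth.

Theorem theorem1p1 (R : realType) (k : fieldType) (n : nat)
    (Theta : oriented_graph n) :
  (forall r : rel 'I_n, total_order_rel r ->
     automaton_algebra r (@hk_proj k n Theta)) /\
  (GKdim R (hk_algebra k Theta) \is a fin_num ->
     exists m : int, GKdim R (hk_algebra k Theta) = (m%:~R)%:E).
Proof.
split=> [r r_total|fin]; first exact: hk_automaton.
have [expo|[e [lower upper]]] := normal_growth_dichotomy Theta; last first.
  exists (Posz e); apply/le_anti/andP.
  split; [exact: hk_GKdim_le upper | exact: hk_GKdim_ge lower].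
(* Exponential growth beats every power, so the dimension exceeds every natural
   number, which is absurd for a finite one. *)
have large e : e%:R <= fine (GKdim R (hk_algebra k Theta)) :> R.
  rewrite -lee_fin fineK //; apply: hk_GKdim_ge; exact: exponential_poly_lower.
have := archi_boundP (le_trans (ler0n _ 0) (large 0%N)).
by rewrite ltNge large.
Qed.
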